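(* Let $f:T'\to T$ be a smooth homomorphism of tori with injective tangent map and let $\tau$ be a positive central extension of $LT$. Let $$T'\xrightarrow{q}T'/\ker(f)\xrightarrow{i_1}T'/\ker(f)\times(T'/\ker(f))^\perp\xrightarrow{f\cdot j}T$$ be the canonical decomposition of $f$ associated with $\tau$ described in the context. Then $$\mathrm{char}(f)=\mathrm{char}(q)\circ\mathrm{char}(i_1)\circ\mathrm{char}(f\cdot j)$$ as homomorphisms $\mathrm{char}(T,\tau)\to\mathrm{char}(T',f^*\tau)$.
   Context: For a torus $T$ with Lie algebra $\mathfrak t$ let $LT=C^\infty(S^1,T)$, on which $\mathbb T_{rot}=S^1$ acts by rotating the parameter, with infinitesimal generator $d$. A central extension $1\to U(1)\xrightarrow{i}LT^\tau\xrightarrow{p}LT\to1$ is admissible if (1) the $\mathbb T_{rot}$-action lifts to $LT^\tau$, and (2) there is an $LT^\tau\rtimes\mathbb T_{rot}$-invariant symmetric bilinear form $\ll\cdot,\cdot\gg_\tau$ on $L\mathfrak t^\tau\oplus i\mathbb R_{rot}$ with $\ll K,d\gg_\tau=-1$, $K$ the infinitesimal generator of $i(U(1))$. It is positive if the restriction of the form to $L\mathfrak t$ (embedded by the splitting which the form determines) is positive definite. For a homomorphism $f:T'\to T$, $f^*\tau$ is the pull-back of the extension along $Lf:LT'\to LT$, $l\mapsto f\circ l$. $\Pi_T=\ker(\exp:\mathfrak t\to T)$, $\Lambda_T=\mathrm{Hom}(\Pi_T,\mathbb Z)\cong\mathrm{Hom}(T,U(1))$. $T^\tau$ is the restriction of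 $LT^\tau$ to constant loops; $\Lambda_T^\tau$ is the set of homomorphisms $\lambda:T^\tau\to U(1)$ with $\lambda\circ i=\mathrm{id}$; $\Lambda_T$ acts on it by tensor product, written $+$. $\kappa^\tau:\Pi_T\to\Lambda_T$ sends $X$ to the character $t\mapsto\tilde\phi_X\tilde t\tilde\phi_X^{-1}\tilde t^{-1}\in i(U(1))$, where $\phi_X\in LT$ is the geodesic loop starting at the unit corresponding to $X$ and tildes are lifts to $LT^\tau$. $\Pi_T$ acts on $\Lambda_T^\tau$ by $n\cdot\lambda=\lambda+\kappa^\tau(n)$; $[\lambda]_T$ is the orbit. The form $\langle n,m\rangle_\tau=-\kappa^\tau(n)(m)$ (up to a positive normalization constant), extended to $\mathfrak t$, is symmetric, and positive definite for positive $\tau$. ${}^tdf:\Lambda^\tau_T\to\Lambda^{f^*\tau}_{T'}$ is pull-back of characters along the induced map $T'^{f^*\tau}\to T^\tau$. $\mathrm{char}(T,\tau)=\mathbb Z[\Lambda_T^\tau/\kappa^\tau(\Pi_T)]$ is the free abelian group on the set of $\Pi_T$-orbits in $\Lambda_T^\tau$. For a homomorphism $f:T'\to T$ of tori with $df$ injective and $\tau$ positive, ${}^tdf(\Pi_T.\lambda)$ is $\Pi_{T'}$-invariant and is a finite disjoint union of orbits $\coprod_{i=1}^k\Pi_{T'}.\mu_i$; $\mathrm{char}(f)([\lambda]_T):=\sum_{i=1}^k[\mu_i]_{T'}$. (In general $\mathrm{char}(g\circ f)\ne\mathrm{char}(f)\circ\mathrm{char}(g)$.) Canonical decomposition: $q$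 is the quotient map (a finite covering); $(T'/\ker(f))^\perp=df(\mathfrak t')^\perp/(df(\mathfrak t')^\perp\cap\Pi_T)\subseteq T$ is a torus, $\perp$ taken in $\mathfrak t$ with respect to $\langle\cdot,\cdot\rangle_\tau$; $j$ is its inclusion in $T$; $i_1$ is the inclusion of the first factor; $(f\cdot j)(t_1,t_2)=f(t_1)j(t_2)$, where $f$ also denotes the induced map on $T'/\ker(f)$. The central extensions used on $L$ of the intermediate tori are the pull-backs of $\tau$. *)

(* Defs.v *)
From HB Require Import structures.
From mathcomp Require Import all_boot all_order all_algebra.
From mathcomp Require Import all_classical all_reals all_analysis.
From mathcomp.real_closed Require Import complex.
From mathcomp.multinomials Require Import freeg.

Set Implicit Arguments.
Unset Strict Implicit.
Unset Printing Implicit Defensive.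

Import Order.TTheory GRing.Theory Num.Theory.
Import numFieldNormedType.Exports.

Local Open Scope classical_set_scope.
Local Open Scope ring_scope.

(** Smooth functions of one and two real variables, with values in [R] or in
    a finite-dimensional vector space. *)
Section Smooth.
Context {R : realType}.

Definition smooth1 (g : R -> R) : Prop :=
  forall n x, derivable (derive1n n g) x 1.

Fixpoint Ck2 (k : nat) (g : R -> R -> R) : Prop :=
  if k is k'.+1 then
    [/\ forall s x, derivable (g^~ x) s 1 /\ derivable (g s) x 1,
        Ck2 k' (fun s x => derive1 (g^~ x) s) &
        Ck2 k' (fun s x => derive1 (g s) x)]
  else continuous (fun z : R * R => g z.1 z.2).

Definition smooth2 (g : R -> R -> R) : Prop := forall k, Ck2 k g.

Definition smoothV1 (V : vectType R) (g : R -> V) : Prop :=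
  forall l : 'Hom(V, R^o), smooth1 (fun x => l (g x)).

Definition smoothV2 (V : vectType R) (g : R -> R -> V) : Prop :=
  forall l : 'Hom(V, R^o), smooth2 (fun s x => l (g s x)).

Lemma derive1nD n (g h : R -> R) : smooth1 g -> smooth1 h ->
  derive1n n (g + h) = derive1n n g + derive1n n h.
Proof.
move=> sg sh; elim: n => [|n IHn] //; rewrite !derive1nS IHn.
by apply/funext => x; rewrite !fctE !derive1E deriveD.
Qed.

Lemma derive1nZ n (a : R) (g : R -> R) : smooth1 g ->
  derive1n n (a *: g) = a *: derive1n n g.
Proof.
move=> sg; elim: n => [|n IHn] //; rewrite !derive1nS IHn.
by apply/funext => x; rewrite !fctE !derive1E deriveZ.
Qed.

Lemma smooth1D (g h : R -> R) : smooth1 g -> smooth1 h -> smooth1 (g + h).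
Proof. by move=> sg sh n x; rewrite derive1nD//; apply: derivableD. Qed.

Lemma smooth1Z a (g : R -> R) : smooth1 g -> smooth1 (a *: g).
Proof. by move=> sg n x; rewrite derive1nZ//; apply: derivableZ. Qed.

Lemma smooth1_cst0 : smooth1 0.
Proof.
suff z n : derive1n n (0 : R -> R) = 0 by move=> n x; rewrite z; exact: derivable_cst.
elim: n => [|n IHn] //; rewrite derive1nS IHn.
by apply/funext => x; rewrite derive1E derive_cst.
Qed.

Lemma smoothV1D (V : vectType R) (g h : R -> V) :
  smoothV1 g -> smoothV1 h -> smoothV1 (g + h).
Proof.
move=> sg sh l; rewrite (_ : (fun x => _) = (fun x => l (g x)) + (fun x => l (h x))).
  exact: smooth1D (sg l) (sh l).
by apply/funext => x; rewrite !fctE linearD.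
Qed.

Lemma smoothV1Z (V : vectType R) a (g : R -> V) : smoothV1 g -> smoothV1 (a *: g).
Proof.
move=> sg l; rewrite (_ : (fun x => _) = a *: (fun x => l (g x) : R)).
  exact: smooth1Z (sg l).
by apply/funext => x; rewrite !fctE linearZ.
Qed.

Lemma smoothV1_0 (V : vectType R) : smoothV1 (0 : R -> V).
Proof.
move=> l; rewrite (_ : (fun x => _) = 0); first exact: smooth1_cst0.
by apply/funext => x; rewrite linear0.
Qed.

Lemma smoothV1_lin (V W : vectType R) (d : {linear V -> W}) (g : R -> V) :
  smoothV1 g -> smoothV1 (d \o g).
Proof.
move=> sg l; have := sg (l \o linfun d)%VF; congr smooth1.
by apply/funext => x; rewrite !lfunE /= lfunE.
Qed.

End Smooth.

Section CircleGroup.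
Variable R : realType.

Definition U1 := {z : R[i] | `|z| == 1}.
HB.instance Definition _ := SubChoice.on U1.

Fact U1_one_subproof : `|1 : R[i]| == 1. Proof. by rewrite normr1. Qed.
Fact U1_mul_subproof (u v : U1) : `|val u * val v| == 1.
Proof. by rewrite normrM (eqP (valP u)) (eqP (valP v)) mulr1. Qed.
Fact U1_inv_subproof (u : U1) : `|(val u)^-1| == 1.
Proof. by rewrite normfV (eqP (valP u)) invr1. Qed.

Definition U1_one : U1 := exist _ 1 U1_one_subproof.
Definition U1_mul (u v : U1) : U1 := exist _ (val u * val v) (U1_mul_subproof u v).
Definition U1_inv (u : U1) : U1 := exist _ (val u)^-1 (U1_inv_subproof u).

Fact U1_mulA : associative U1_mul.
Proof. by move=> u v w; apply/val_inj; rewrite /= mulrA. Qed.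
Fact U1_mul1 : left_id U1_one U1_mul.
Proof. by move=> u; apply/val_inj; rewrite /= mul1r. Qed.
Fact U1_mulr1 : right_id U1_one U1_mul.
Proof. by move=> u; apply/val_inj; rewrite /= mulr1. Qed.
Fact U1_neq0 (u : U1) : val u != 0.
Proof. by rewrite -normr_eq0 (eqP (valP u)) oner_eq0. Qed.
Fact U1_mulV : left_inverse U1_one U1_inv U1_mul.
Proof. by move=> u; apply/val_inj; rewrite /= mulVf ?U1_neq0. Qed.
Fact U1_mulrV : right_inverse U1_one U1_inv U1_mul.
Proof. by move=> u; apply/val_inj; rewrite /= mulfV ?U1_neq0. Qed.

HB.instance Definition _ :=
  isGroup.Build U1 U1_mulA U1_mul1 U1_mulr1 U1_mulV U1_mulrV.

End CircleGroup.

Definition ReU {R : realType} (u : U1 R) : R := complex.Re (val u).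
Definition ImU {R : realType} (u : U1 R) : R := complex.Im (val u).
Definition smoothU1 {R : realType} (u : R -> U1 R) : Prop :=
  smooth1 (ReU \o u) /\ smooth1 (ImU \o u).

(** A connected abelian Lie group, written additively, is presented by its
    exponential map; a map into it is smooth when it is locally [exp] of a
    smooth map into the Lie algebra.  It is a torus when the kernel of [exp]
    is a full lattice.  The lattice condition is a separate predicate so that
    T'/ker f and the torus orthogonal to its image can be constructed before
    one knows that they are compact. *)
Record expGroup (R : realType) := ExpGroup {
  carrier :> zmodType;
  lie : vectType R;
  texp : {additive lie -> carrier};
  texp_surj : forall t, exists x, texp x = t }.

Definition is_torus (R : realType) (T : expGroup R) : Prop :=
  exists b : (\dim {: lie T}).-tuple (lie T),
    basis_of {: lie T} b /\
    forall x : lie T, texp T x = 0 <->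
      exists z : 'I_(\dim {: lie T}) -> int, x = \sum_(i < \dim {: lie T}) b`_i *~ z i.

(** A smooth homomorphism together with its tangent map. *)
Record thom (R : realType) (S T : expGroup R) := THom {
  thfun :> {additive S -> T};
  tangent : {linear lie S -> lie T};
  thomE : forall x, thfun (texp S x) = texp T (tangent x) }.

(** S^1 is R/(2 pi)Z, so that loops are 2 pi-periodic functions on R. *)
Section Loops.
Variables (R : realType) (T : expGroup R).

Definition LT : set (R -> T) := [set l |
  (forall x, l (x + 2 * pi) = l x) /\
  forall x0 : R, exists2 g : R -> lie T, smoothV1 g & \forall x \near x0, l x = texp T (g x)].

(** A smooth curve s |-> c s in LT is a smooth map on R x S^1. *)
Definition LT_curve : set (R -> R -> T) := [set c |
  (forall s x, c s (x + 2 * pi) = c s x) /\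
  forall s0 x0 : R, exists2 g : R -> R -> lie T, smoothV2 g &
    \forall s \near s0 & x \near x0, c s x = texp T (g s x)].

(** The Frechet topology of LT is the final topology for its smooth curves. *)
Definition LT_open (U : set (R -> T)) : Prop :=
  forall c, LT_curve c -> forall s0 : R, U (c s0) -> \forall s \near s0, U (c s).

Definition Lt_pred : {pred R -> lie T} := fun xi =>
  `[< (forall x, xi (x + 2 * pi) = xi x) /\ smoothV1 xi >].

Fact Lt_submod : submod_closed Lt_pred.
Proof.
split; first by apply/asboolP; split=> //; exact: smoothV1_0.
move=> a u v /asboolP[pu su] /asboolP[pv sv]; apply/asboolP; split.
  by move=> x; rewrite !fctE pu pv.
exact: smoothV1D (smoothV1Z su) sv.
Qed.

HB.instance Definition _ := GRing.isSubmodClosed.Build R (R -> lie T) Lt_pred Lt_submod.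

Record Lt := MkLt { Lt_val : R -> lie T; Lt_valP : Lt_val \in Lt_pred }.
HB.instance Definition _ := [isSub for Lt_val].
HB.instance Definition _ := [Choice of Lt by <:].
HB.instance Definition _ := [SubChoice_isSubLmodule of Lt by <:].

Definition loop_tangent (c : R -> R -> T) (xi : Lt) : Prop :=
  forall x0, exists g : R -> R -> lie T,
    [/\ smoothV2 g,
        \forall s \near (0 : R) & x \near x0, c s x = texp T (g s x) &
        forall l : 'Hom(lie T, R^o), derive1 (fun s => l (g s x0) : R) 0 = l (val xi x0)].

Definition geodesic (X : lie T) : R -> T := fun x => texp T ((x / (2 * pi)) *: X).

Lemma LT0 : LT 0.
Proof.
split=> // x0; exists 0; first exact: smoothV1_0.
by near=> x; rewrite raddf0.
Unshelve. all: by end_near. Qed.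

Lemma LTD l m : LT l -> LT m -> LT (l + m).
Proof.
move=> [pl sl] [pm sm]; split; first by move=> x; rewrite !fctE pl pm.
move=> x0; have [g sg lg] := sl x0; have [h sh mh] := sm x0.
exists (g + h); first exact: smoothV1D.
by near=> x; rewrite !fctE raddfD; congr (_ + _); near: x.
Unshelve. all: by end_near. Qed.

Lemma LTN l : LT l -> LT (- l).
Proof.
move=> [pl sl]; split; first by move=> x; rewrite !fctE pl.
move=> x0; have [g sg lg] := sl x0; exists (-1 *: g); first exact: smoothV1Z.
by near=> x; rewrite !fctE scaleN1r raddfN; congr (- _); near: x.
Unshelve. all: by end_near. Qed.

End Loops.

Lemma LT_comp (R : realType) (S T : expGroup R) (f : thom S T) (l : R -> S) :
  LT l -> LT (f \o l).
Proof.
move=> [pl sl]; split; first by move=> x; rewrite /= pl.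
move=> x0; have [g sg lg] := sl x0; exists (tangent f \o g); first exact: smoothV1_lin.
by near=> x; rewrite /= -thomE; congr (f _); near: x.
Unshelve. all: by end_near. Qed.

(** A central extension of LT by U(1).  The smooth structure of the total
    group is carried by the set [csm] of its smooth curves (which determines
    the structure of a Frechet manifold); [smooth_ext] below says that they
    make it a Lie group and a smooth principal U(1)-bundle over LT. *)
Record cext (R : realType) (T : expGroup R) := CExt {
  ctot :> groupType;
  ci : U1 R -> ctot;
  cp : ctot -> R -> T;
  csm : set (R -> ctot);
  ciM : forall u v, ci (u * v)%g = (ci u * ci v)%g;
  ci_inj : injective ci;
  ci_central : forall u g, (ci u * g = g * ci u)%g;
  cpM : forall g h, cp (g * h)%g = cp g + cp h;
  cp_range : range cp = @LT R T;
  cp_ker : forall g, cp g = 0 <-> exists u, g = ci u }.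

Section Extensions.
Variables (R : realType) (T : expGroup R) (tau : cext T).

(** A section of LT^tau -> LT which is smooth near the unit; it trivializes
    the bundle near the unit. *)
Definition local_section (U : set (R -> T)) (sigma : (R -> T) -> tau) : Prop :=
  [/\ LT_open U, U 0, sigma 0 = 1%g,
      forall l, LT l -> U l -> cp (sigma l) = l &
      forall c, LT_curve c -> (forall s, U (c s)) -> csm (sigma \o c)].

Record smooth_ext : Prop := SmoothExt {
  csm_cst : forall g : tau, csm (fun=> g);
  csm_mul : forall c d : R -> tau, csm c -> csm d -> csm (fun s => c s * d s)%g;
  csm_inv : forall c : R -> tau, csm c -> csm (fun s => (c s)^-1)%g;
  csm_reparam : forall (c : R -> tau) h, csm c -> smooth1 h -> csm (c \o h);
  csm_local : forall c : R -> tau,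
    (forall s0 : R, exists2 d, csm d & \forall s \near s0, c s = d s) -> csm c;
  csm_ci : forall u : R -> U1 R, csm (ci tau \o u) <-> smoothU1 u;
  csm_cp : forall c : R -> tau, csm c -> LT_curve (fun s => cp (c s));
  csm_section : exists U sigma, local_section U sigma }.

(** A lift to LT^tau of the action (a . l)(x) = l (x + a) of the rotation
    group R/(2 pi)Z on LT. *)
Record rot_lift (rho : R -> tau -> tau) : Prop := RotLift {
  rho0 : forall g, rho 0 g = g;
  rhoD : forall a b g, rho (a + b) g = rho a (rho b g);
  rho_period : forall g, rho (2 * pi) g = g;
  rhoM : forall a g h, rho a (g * h)%g = (rho a g * rho a h)%g;
  rho_ci : forall a u, rho a (ci tau u) = ci tau u;
  rho_cp : forall a g x, cp (rho a g) x = cp g (x + a);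
  rho_smooth : forall (c : R -> tau) h, csm c -> smooth1 h ->
    csm (fun s => rho (h s) (c s)) }.

(** The Lie algebra of LT^tau x| T_rot, that is the tangent space at the unit,
    read in the trivialization given by a local section sigma: (xi, a, r) is
    the velocity at s = 0 of s |-> (sigma (exp (s xi)) * i (e^(i a s)), r s). *)
Definition hatLt : lmodType R := (Lt T * R^o * R^o)%type.
Definition genK : hatLt := (0, 1, 0).
Definition gend : hatLt := (0, 0, 1).

Definition hat_tangent (sigma : (R -> T) -> tau)
    (c : R -> tau) (r : R -> R) (v : hatLt) : Prop :=
  [/\ csm c, smooth1 r, c 0 = 1%g, r 0 = 0 &
   [/\ loop_tangent (fun s => cp (c s)) v.1.1,
       exists u : R -> U1 R,
         [/\ smoothU1 u, u 0 = 1%g,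
             \forall s \near (0 : R), c s = (sigma (cp (c s)) * ci tau (u s))%g &
             derive1 (ImU \o u) 0 = v.1.2] &
       derive1 r 0 = v.2]].

(** [conj_curve rho g a c r] and [r] are the components of the conjugate of
    the curve (c, r) by (g, a), in the semidirect product with multiplication
    (g, a) (h, b) = (g * rho a h, a + b). *)
Definition conj_curve (rho : R -> tau -> tau) (g : tau) (a : R)
    (c : R -> tau) (r : R -> R) : R -> tau :=
  fun s => (g * rho a (c s) * (rho (r s) g)^-1)%g.

Definition ad_invariant (sigma : (R -> T) -> tau) (rho : R -> tau -> tau)
    (B : hatLt -> hatLt -> R^o) : Prop :=
  forall g a c1 r1 v1 w1 c2 r2 v2 w2,
    hat_tangent sigma c1 r1 v1 -> hat_tangent sigma c2 r2 v2 ->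
    hat_tangent sigma (conj_curve rho g a c1 r1) r1 w1 ->
    hat_tangent sigma (conj_curve rho g a c2 r2) r2 w2 ->
    B w1 w2 = B v1 v2.

Definition admissible_form (sigma : (R -> T) -> tau) (rho : R -> tau -> tau)
    (B : {bilinear hatLt -> hatLt -> R^o}) : Prop :=
  [/\ forall v w, B v w = B w v, ad_invariant sigma rho B & B genK gend = -1].

(** Lt embeds in Lt^tau as the orthogonal of d, which is a complement of the
    line spanned by K. *)
Definition positive_form (B : {bilinear hatLt -> hatLt -> R^o}) : Prop :=
  forall (xi : Lt T) (a : R), B (xi, a, 0) gend = 0 -> xi != 0 ->
    0 < (B (xi, a, 0) (xi, a, 0) : R).

Definition positive_ext : Prop :=
  smooth_ext /\ exists U sigma rho B,
    [/\ local_section U sigma, rot_lift rho,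
        admissible_form sigma rho B & positive_form B].

Definition ctorus_pred : {pred tau} := fun g => `[< exists t, cp g = fun=> t >].

Lemma cp1 : cp (1%g : tau) = 0.
Proof. by apply: (@addrI _ (cp (1%g : tau))); rewrite -cpM mulg1 addr0. Qed.

Lemma cpV (g : tau) : cp (g^-1)%g = - cp g.
Proof. by apply: (@addrI _ (cp g)); rewrite -cpM mulgV cp1 subrr. Qed.

Fact ctorus_closed : group_closed ctorus_pred.
Proof.
split; first by apply/asboolP; exists 0; rewrite cp1.
move=> g h /asboolP[t gt] /asboolP[t' ht']; apply/asboolP; exists (t - t').
by rewrite cpM cpV gt ht'.
Qed.

(** T^tau, the restriction of the extension to constant loops *)
Record ctorus := MkCtorus { ctorus_val : tau; ctorus_valP : ctorus_val \in ctorus_pred }.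
HB.instance Definition _ := [isSub for ctorus_val].
HB.instance Definition _ := [Choice of ctorus by <:].
HB.instance Definition _ := SubChoice_isSubGroup.Build tau ctorus_pred ctorus ctorus_closed.

(** Lambda^tau_T *)
Record weight := Weight {
  wfun :> ctorus -> U1 R;
  wM : forall x y, wfun (x * y)%g = (wfun x * wfun y)%g;
  w_ci : forall x u, val x = ci tau u -> wfun x = u;
  w_smooth : forall c : R -> ctorus, csm (val \o c) -> smoothU1 (wfun \o c) }.

(** The commutator of any lifts of two loops; the value 1 is a default. *)
Definition comm_pairing (l m : R -> T) : U1 R :=
  xget 1%g [set u | exists g h : tau,
    [/\ cp g = l, cp h = m & ci tau u = (g * h * g^-1 * h^-1)%g]].

Definition kappa (X : lie T) (t : T) : U1 R := comm_pairing (geodesic X) (fun=> t).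

Definition worbit (lambda : weight) : set weight := [set mu |
  exists2 n : lie T, texp T n = 0 &
    forall x : ctorus, mu x = (lambda x * kappa n (cp (val x) 0))%g].

Definition orbit_space :=
  {A : set weight | `[< exists lambda, A = worbit lambda >]}.
HB.instance Definition _ := Choice.on orbit_space.

(** kappa(n)(m), the character kappa(n) being seen in Hom(Pi_T, Z) through
    its derivative divided by 2 pi i. *)
Definition kappa_num (n m : lie T) : R :=
  derive1 (fun s : R => ImU (kappa n (texp T (s *: m)))) 0 / (2 * pi).

(** The bilinear extension to t of (n, m) |-> - kappa(n)(m) on Pi_T; it is
    unique when T is a torus since Pi_T spans t. *)
Definition tau_form : lie T -> lie T -> R^o :=
  xget (fun _ _ => 0) [set b |
    [/\ forall x, linear (b x), forall y, linear (b^~ y) &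
        forall n m, texp T n = 0 -> texp T m = 0 -> b n m = - kappa_num n m]].

End Extensions.
Arguments ctorus_pred {R T} tau.

Definition char_group (R : realType) (T : expGroup R) (tau : cext T) : lmodType int :=
  {freeg (orbit_space tau)}.

(** A map of extensions covering Lf : LT' -> LT and the identity of U(1);
    it exhibits tau' as the pull-back of tau along Lf. *)
Record emap (R : realType) (T' T : expGroup R) (f : thom T' T)
    (tau' : cext T') (tau : cext T) := EMap {
  emfun :> tau' -> tau;
  emM : forall g h, emfun (g * h)%g = (emfun g * emfun h)%g;
  em_ci : forall u, emfun (ci tau' u) = ci tau u;
  em_cp : forall g, cp (emfun g) = f \o cp g;
  em_csm : forall c, csm c -> csm (emfun \o c) }.

Section Char.
Variables (R : realType) (T' T : expGroup R) (f : thom T' T).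
Variables (tau' : cext T') (tau : cext T) (F : emap f tau' tau).

Fact ectorus_subproof (x : ctorus tau') : F (val x) \in ctorus_pred tau.
Proof.
case/asboolP: (ctorus_valP x) => t xt; apply/asboolP; exists (f t).
by rewrite em_cp /= xt.
Qed.

Definition ectorus (x : ctorus tau') : ctorus tau := MkCtorus (ectorus_subproof x).

Fact tdf_M (lambda : weight tau) x y :
  lambda (ectorus (x * y)%g) = (lambda (ectorus x) * lambda (ectorus y))%g.
Proof. by rewrite -wM; congr (lambda _); apply/val_inj; rewrite /= emM. Qed.

Fact tdf_ci (lambda : weight tau) (x : ctorus tau') u :
  val x = ci tau' u -> lambda (ectorus x) = u.
Proof. by move=> xu; apply: w_ci; rewrite /= -[ctorus_val x]/(val x) xu em_ci. Qed.

Fact tdf_smooth (lambda : weight tau) (c : R -> ctorus tau') :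
  csm (val \o c) -> smoothU1 ((lambda \o ectorus) \o c).
Proof. by move=> sc; apply: (w_smooth lambda (c := ectorus \o c)); exact: em_csm sc. Qed.

Definition tdf (lambda : weight tau) : weight tau' :=
  @Weight R T' tau' (lambda \o ectorus) (tdf_M lambda) (@tdf_ci lambda)
    (@tdf_smooth lambda).

(** The sum of the orbits of which tdf(Pi_T . lambda) is the disjoint union;
    [\sum_(_ \in _)] is 0 on an infinite index set. *)
Definition char_orbit (O : orbit_space tau) : char_group tau' :=
  \sum_(O' \in [set O' : orbit_space tau' | val O' `<=` tdf @` val O])
    (<< O' >> : {freeg (orbit_space tau')}).

Definition char (x : char_group tau) : char_group tau' := fglift char_orbit x.

End Char.

(** The pull-back of the extension tau along La : LS -> LT. *)
Section Pullback.
Variables (R : realType) (S T : expGroup R) (a : thom S T) (tau : cext T).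

Definition pb_pred : {pred (R -> S) * tau} :=
  fun x => `[< LT x.1 /\ cp x.2 = a \o x.1 >].

Record pb_car := MkPb { pb_val : (R -> S) * tau; pb_valP : pb_val \in pb_pred }.
HB.instance Definition _ := [isSub for pb_val].
HB.instance Definition _ := [Choice of pb_car by <:].

Fact pb_one_subproof : (0, 1%g) \in pb_pred.
Proof.
apply/asboolP; split; first exact: LT0.
by rewrite cp1; apply/funext => x; rewrite /= raddf0.
Qed.
Fact pb_mul_subproof (x y : pb_car) :
  ((val x).1 + (val y).1, ((val x).2 * (val y).2)%g) \in pb_pred.
Proof.
case/asboolP: (pb_valP x) => lx ex; case/asboolP: (pb_valP y) => ly ey.
apply/asboolP; split; first exact: LTD.
by rewrite cpM ex ey; apply/funext => t; rewrite /= raddfD.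
Qed.
Fact pb_inv_subproof (x : pb_car) : (- (val x).1, ((val x).2^-1)%g) \in pb_pred.
Proof.
case/asboolP: (pb_valP x) => lx ex; apply/asboolP; split; first exact: LTN.
by rewrite cpV ex; apply/funext => t; rewrite /= raddfN.
Qed.

Definition pb_one := MkPb pb_one_subproof.
Definition pb_mul x y := MkPb (pb_mul_subproof x y).
Definition pb_inv x := MkPb (pb_inv_subproof x).

Fact pb_mulA : associative pb_mul.
Proof. by move=> x y z; apply/val_inj; rewrite /= addrA mulgA. Qed.
Fact pb_mul1 : left_id pb_one pb_mul.
Proof. by move=> x; apply/val_inj; rewrite /= add0r mul1g; case: (pb_val x). Qed.
Fact pb_mulr1 : right_id pb_one pb_mul.
Proof. by move=> x; apply/val_inj; rewrite /= addr0 mulg1; case: (pb_val x). Qed.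
Fact pb_mulV : left_inverse pb_one pb_inv pb_mul.
Proof. by move=> x; apply/val_inj; rewrite /= addNr mulVg. Qed.
Fact pb_mulrV : right_inverse pb_one pb_inv pb_mul.
Proof. by move=> x; apply/val_inj; rewrite /= subrr mulgV. Qed.

HB.instance Definition _ :=
  isGroup.Build pb_car pb_mulA pb_mul1 pb_mulr1 pb_mulV pb_mulrV.

Fact pb_ci_subproof (u : U1 R) : (0, ci tau u) \in pb_pred.
Proof.
apply/asboolP; split; first exact: LT0.
rewrite (_ : cp _ = 0); last by apply/cp_ker; exists u.
by apply/funext => x; rewrite /= raddf0.
Qed.

Definition pb_ci (u : U1 R) : pb_car := MkPb (pb_ci_subproof u).
Definition pb_cp (x : pb_car) : R -> S := (val x).1.
Definition pb_csm : set (R -> pb_car) := [set c |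
  LT_curve (fun s => pb_cp (c s)) /\ csm (fun s => (val (c s)).2)].

Fact pb_ciM u v : pb_ci (u * v)%g = (pb_ci u * pb_ci v)%g.
Proof. by apply/val_inj; rewrite /= addr0 ciM. Qed.
Fact pb_ci_inj : injective pb_ci.
Proof. by move=> u v /(congr1 val) [] /ci_inj. Qed.
Fact pb_ci_central u g : (pb_ci u * g = g * pb_ci u)%g.
Proof. by apply/val_inj; rewrite /= addr0 add0r ci_central. Qed.
Fact pb_cpM g h : pb_cp (g * h)%g = pb_cp g + pb_cp h.
Proof. by []. Qed.
Fact pb_cp_range : range pb_cp = @LT R S.
Proof.
apply/seteqP; split=> l; first by case=> x _ <-; case/asboolP: (pb_valP x).
move=> Ll; have : range (cp (c := tau)) (a \o l) by rewrite cp_range; exact: LT_comp.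
case=> g _ gl; have lg : (l, g) \in pb_pred by apply/asboolP; split.
by exists (MkPb lg).
Qed.
Fact pb_cp_ker g : pb_cp g = 0 <-> exists u, g = pb_ci u.
Proof.
split=> [g0|[u ->]] //; case/asboolP: (pb_valP g) => _; rewrite -/(val g) -/(pb_cp g) g0 => eg.
have /cp_ker[u gu] : cp (val g).2 = 0.
  by rewrite eg; apply/funext => x; rewrite /= raddf0.
exists u; apply/val_inj; rewrite /= -gu -g0 /pb_cp; exact: surjective_pairing.
Qed.

Definition pullback : cext S :=
  @CExt R S pb_car pb_ci pb_cp pb_csm pb_ciM pb_ci_inj pb_ci_central pb_cpM
    pb_cp_range pb_cp_ker.

Definition pb_proj : emap a pullback tau.
Proof.
apply: (@EMap R S T a pullback tau (fun x : pb_car => (val x).2)) => //.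
- by move=> g; case/asboolP: (pb_valP g).
- by move=> c [].
Defined.

End Pullback.
Arguments pb_pred {R S T} a tau.

Lemma LT_curve_comp (R : realType) (S T : expGroup R) (f : thom S T) (c : R -> R -> S) :
  LT_curve c -> LT_curve (fun s => f \o c s).
Proof.
move=> [pc sc]; split; first by move=> s x; rewrite /= pc.
move=> s0 x0; have [g sg cg] := sc s0 x0; exists (fun s x => tangent f (g s x)).
  move=> l; have := sg (l \o linfun (tangent f))%VF; congr smooth2.
  by apply/funext => s; apply/funext => x; rewrite !lfunE /= lfunE.
by apply: filterS cg => -[s x] /= ->; rewrite thomE.
Qed.

(** For b = a o h, the map (l, g) |-> (h o l, g) from the pull-back of tau
    along Lb to the pull-back of tau along La, covering Lh. *)
Section PullbackMap.
Variables (R : realType) (S' S T : expGroup R) (h : thom S' S) (a : thom S T)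
  (b : thom S' T) (abh : forall x, a (h x) = b x) (tau : cext T).

Fact pb_map_subproof (x : pb_car b tau) : (h \o (val x).1, (val x).2) \in pb_pred a tau.
Proof.
case/asboolP: (pb_valP x) => lx ex; apply/asboolP; split; first exact: LT_comp.
by rewrite /= ex; apply/funext => t /=; rewrite abh.
Qed.

Definition pb_map : emap h (pullback b tau) (pullback a tau).
Proof.
apply: (@EMap R S' S h (pullback b tau) (pullback a tau)
  (fun x : pb_car b tau => MkPb (pb_map_subproof x))) => //.
- move=> x y; apply/val_inj => /=; congr (_, _).
  by apply/funext => t; rewrite /= raddfD.
- by move=> u; apply/val_inj => /=; congr (_, _); apply/funext => t; rewrite /= raddf0.
- by move=> c [c1 c2]; split=> //; exact: LT_curve_comp c1.
Defined.

End PullbackMap.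

Definition thom_comp (R : realType) (S T W : expGroup R) (g : thom T W) (f : thom S T) :
  thom S W.
Proof.
by exists (g \o f : {additive S -> W}) (tangent g \o tangent f : {linear lie S -> lie W})
  => x; rewrite /= !thomE.
Defined.

(** The quotient of an abelian group by the kernel of an additive map. *)
Section KernelQuotient.
Variables (A B : zmodType) (g : {additive A -> B}).

Definition kerp : {pred A} := fun x => g x == 0.
Fact kerp_closed : zmod_closed kerp.
Proof.
split; first by rewrite unfold_in raddf0.
by move=> x y; rewrite !unfold_in raddfB => /eqP-> /eqP->; rewrite subrr.
Qed.
HB.instance Definition _ := GRing.isZmodClosed.Build A kerp kerp_closed.

Definition kerquot : zmodType := Quotient.quot kerp.

Definition kerpi (x : A) : kerquot := (\pi_(Quotient.quot kerp) x)%qT.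
Fact kerpi_additive : additive kerpi.
Proof. by move=> x y; rewrite /kerpi !piE. Qed.
HB.instance Definition _ := GRing.isAdditive.Build A kerquot kerpi kerpi_additive.

Definition kerbar (y : kerquot) : B := g (repr y).

Lemma kerbarE x : kerbar (kerpi x) = g x.
Proof.
apply/eqP; rewrite -subr_eq0 -raddfB -[_ == 0]/(_ \in kerp) Quotient.idealrBE.
by rewrite reprK.
Qed.

Lemma kerpi_surj y : exists x, kerpi x = y.
Proof. by exists (repr y); rewrite /kerpi reprK. Qed.

Fact kerbar_additive : additive kerbar.
Proof.
move=> x y; have [x' <-] := kerpi_surj x; have [y' <-] := kerpi_surj y.
by rewrite -raddfB !kerbarE raddfB.
Qed.
HB.instance Definition _ := GRing.isAdditive.Build kerquot B kerbar kerbar_additive.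

End KernelQuotient.
Arguments kerbar {A B} g y.

Section Decomposition.
Variable R : realType.

Section Quotient.
Variables (T' T : expGroup R) (f : thom T' T).

Fact quot_surj (y : kerquot f) : exists x, (kerpi f \o texp T') x = y.
Proof.
have [t <-] := kerpi_surj y; have [x <-] := texp_surj t; by exists x.
Qed.

(** T'/ker f, with Lie algebra that of T' *)
Definition quot_torus : expGroup R :=
  @ExpGroup R (kerquot f) (lie T') (kerpi f \o texp T' : {additive lie T' -> kerquot f})
    quot_surj.

Definition quot_map : thom T' quot_torus :=
  @THom R T' quot_torus (kerpi f) idfun (fun x => erefl).

Fact quot_indE x : kerbar f (texp quot_torus x) = texp T (tangent f x).
Proof. by rewrite /= kerbarE thomE. Qed.

Definition quot_ind : thom quot_torus T :=
  @THom R quot_torus T (kerbar f) (tangent f) quot_indE.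

End Quotient.

Section Subtorus.
Variables (T : expGroup R) (W : {vspace lie T}).

Definition sub_exp : {additive subvs_of W -> T} := texp T \o vsval.

Fact sub_surj (y : kerquot sub_exp) : exists x, kerpi sub_exp x = y.
Proof. exact: kerpi_surj. Qed.

(** W / (W :&: Pi_T) and its inclusion in T *)
Definition sub_torus : expGroup R :=
  @ExpGroup R (kerquot sub_exp) (subvs_of W) (kerpi sub_exp) sub_surj.

Fact sub_inclE x : kerbar sub_exp (texp sub_torus x) = texp T (vsval x).
Proof. exact: (kerbarE sub_exp x). Qed.

Definition sub_incl : thom sub_torus T :=
  @THom R sub_torus T (kerbar sub_exp) vsval sub_inclE.

End Subtorus.

Section Product.
Variables S1 S2 : expGroup R.

Definition prod_exp (x : lie S1 * lie S2) : S1 * S2 := (texp S1 x.1, texp S2 x.2).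
Fact prod_exp_additive : additive prod_exp.
Proof. by move=> x y; rewrite /prod_exp !raddfB. Qed.
HB.instance Definition _ :=
  GRing.isAdditive.Build (lie S1 * lie S2)%type (S1 * S2)%type prod_exp prod_exp_additive.
Fact prod_exp_surj t : exists x, prod_exp x = t.
Proof.
case: t => t1 t2; have [x1 e1] := texp_surj t1; have [x2 e2] := texp_surj t2.
by exists (x1, x2); rewrite /prod_exp e1 e2.
Qed.

Definition prod_torus : expGroup R :=
  @ExpGroup R (S1 * S2)%type (lie S1 * lie S2)%type prod_exp prod_exp_surj.

Definition incl1 (x : S1) : S1 * S2 := (x, 0).
Fact incl1_additive : additive incl1.
Proof. by move=> x y; rewrite /incl1; congr (_, _); rewrite /= subr0. Qed.
HB.instance Definition _ :=
  GRing.isAdditive.Build S1 (S1 * S2)%type incl1 incl1_additive.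

Definition dincl1 (x : lie S1) : lie S1 * lie S2 := (x, 0).
Fact dincl1_linear : linear dincl1.
Proof. by move=> a x y; rewrite /dincl1; congr (_, _); rewrite /= scaler0 addr0. Qed.
HB.instance Definition _ :=
  GRing.isLinear.Build R (lie S1) (lie S1 * lie S2)%type _ dincl1 dincl1_linear.

Fact incl1E x : incl1 (texp S1 x) = texp prod_torus (dincl1 x).
Proof. by rewrite /= /prod_exp /incl1 /= raddf0. Qed.

Definition prod_incl1 : thom S1 prod_torus := @THom R S1 prod_torus incl1 dincl1 incl1E.

Variables (T : expGroup R) (g1 : thom S1 T) (g2 : thom S2 T).

Definition dotf (x : S1 * S2) : T := g1 x.1 + g2 x.2.
Fact dotf_additive : additive dotf.
Proof. by move=> x y; rewrite /dotf !raddfB opprD addrACA. Qed.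
HB.instance Definition _ :=
  GRing.isAdditive.Build (S1 * S2)%type T dotf dotf_additive.

Definition ddotf (x : lie S1 * lie S2) : lie T := tangent g1 x.1 + tangent g2 x.2.
Fact ddotf_linear : linear ddotf.
Proof. by move=> a x y; rewrite /ddotf !linearP scalerDr addrACA. Qed.
HB.instance Definition _ :=
  GRing.isLinear.Build R (lie S1 * lie S2)%type (lie T) _ ddotf ddotf_linear.

Fact dotfE x : dotf (texp prod_torus x) = texp T (ddotf x).
Proof. by rewrite /dotf /ddotf /= !thomE raddfD. Qed.

Definition prod_dot : thom prod_torus T := @THom R prod_torus T dotf ddotf dotfE.

End Product.

(** The vectors [u] with [b u v = 0] for all [v] in [V] *)
Definition orth_space (E : vectType R) (b : E -> E -> R^o) (V : {vspace E}) : {vspace E} :=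
  (\bigcap_(i < \dim V) lker (linfun (fun u => b u (vbasis V)`_i)))%VS.

Variables (T' T : expGroup R) (f : thom T' T) (tau : cext T).

Definition perp_space : {vspace lie T} :=
  orth_space (tau_form tau) (limg (linfun (tangent f))).

Definition perp_torus : expGroup R := sub_torus perp_space.

Definition decomp_q : thom T' (quot_torus f) := quot_map f.
Definition decomp_i1 : thom (quot_torus f) (prod_torus (quot_torus f) perp_torus) :=
  prod_incl1 (quot_torus f) perp_torus.
Definition decomp_fj : thom (prod_torus (quot_torus f) perp_torus) T :=
  prod_dot (quot_ind f) (sub_incl perp_space).

Fact decompE x : thom_comp decomp_fj decomp_i1 (decomp_q x) = f x.
Proof.
have -> : thom_comp decomp_fj decomp_i1 (decomp_q x)
  = kerbar f (kerpi f x) + sub_incl perp_space 0 by [].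
by rewrite kerbarE raddf0 addr0.
Qed.

End Decomposition.

(* Main.v *)
Require Import Defs.
From HB Require Import structures.
From mathcomp Require Import all_boot all_order all_algebra.
From mathcomp Require Import all_classical all_reals all_analysis.
From mathcomp.real_closed Require Import complex.
From mathcomp.multinomials Require Import freeg.

(** The orbits contained in tdf f (Pi_T . lambda) are those of the weights tdf f mu
    with mu in Pi_T . lambda, and tdf f is the composite of the pull-backs along
    q, i_1 and f.j.  Since kappa n is a one-parameter subgroup along each line, a
    vector n of Pi_T lies in df(t')^perp iff the character kappa n is trivial on
    f(T').  Hence the pull-back along i_1 maps orbits onto orbits, and two orbits in
    the pull-back of Pi_T . lambda along f.j with the same image under it coincide.
    As q is surjective, weights whose pull-backs along q lie in one orbit lie in one
    orbit.  So the set of orbits for f is the disjoint union, over the orbits for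
    f.j, of sets of orbits for q.  The latter are either all finite or all infinite,
    because the translations by kappa n identify them, so both sides vanish together
    when a set of orbits is infinite, infinite sums being 0. *)

Set Implicit Arguments.
Unset Strict Implicit.
Unset Printing Implicit Defensive.

Import Order.TTheory GRing.Theory Num.Theory.
Import numFieldNormedType.Exports.

Local Open Scope classical_set_scope.
Local Open Scope ring_scope.

Lemma U1_mulC (R : realType) : commutative (fun u v : U1 R => (u * v)%g).
Proof. by move=> u v; apply/val_inj; rewrite /= mulrC. Qed.

(** * Commutators of lifts in a central extension *)

Section CommutatorPairing.
Variables (R : realType) (T : expGroup R) (tau : cext T).
Implicit Types (g h : tau) (l m : R -> T) (n : lie T) (t : T).

Let comm g h := (g * h * g^-1 * h^-1)%g.

Lemma LT_lift l : LT l -> exists g : tau, cp g = l.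
Proof. by rewrite -(cp_range tau) => -[g _ gl]; exists g. Qed.

Lemma cp_eq g h : cp g = cp h -> exists u, g = (h * ci tau u)%g.
Proof.
move=> gh; have /cp_ker[u hu] : cp (h^-1 * g)%g = 0 by rewrite cpM cpV gh addNr.
by exists u; rewrite -hu mulgA mulgV mul1g.
Qed.

Lemma comm_ci_l g h u : comm (g * ci tau u)%g h = comm g h.
Proof.
by rewrite /comm -(mulgA g) ci_central invgM !mulgA mulgK.
Qed.

Lemma comm_ci_r g h u : comm g (h * ci tau u)%g = comm g h.
Proof.
by rewrite /comm mulgA -(mulgA _ (ci tau u)) ci_central invgM !mulgA mulgK.
Qed.

(** Two lifts of a loop differ by a central element, which cancels in the commutator. So the lifts
    picked by [xget] may be replaced by any others. *)
Lemma ci_comm_pairing g h :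
  ci tau (comm_pairing tau (cp g) (cp h)) = (g * h * g^-1 * h^-1)%g.
Proof.
set P := [set u | exists g' h' : tau,
  [/\ cp g' = cp g, cp h' = cp h & ci tau u = (g' * h' * g'^-1 * h'^-1)%g]].
have : exists u, P u.
  have /cp_ker[u hu] : cp (comm g h) = 0.
    by rewrite !cpM !cpV addrAC addrK subrr.
  by exists u, g, h.
move=> /(@xgetPex _ 1%g P) [g' [h' [/cp_eq[a ->] /cp_eq[b ->]]]].
rewrite /comm_pairing -/P => ->.
by rewrite -/(comm _ _) comm_ci_l comm_ci_r.
Qed.

Lemma comm_pairingDl l l' m : LT l -> LT l' -> LT m ->
  comm_pairing tau (l + l') m = (comm_pairing tau l m * comm_pairing tau l' m)%g.
Proof.
move=> /LT_lift[g <-] /LT_lift[g' <-] /LT_lift[h <-]; rewrite -cpM.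
apply: (@ci_inj _ _ tau); rewrite ciM -ci_central ci_comm_pairing.
rewrite (ci_comm_pairing g h).
(* Conjugation by [g'] changes [h] only by a central factor, and this factor passes through the
   conjugation by [g]. *)
have E : (g' * h * g'^-1)%g = (ci tau (comm_pairing tau (cp g') (cp h)) * h)%g.
  by rewrite ci_comm_pairing mulgVK.
have -> : (g * g' * h * (g * g')^-1 / h = g * (g' * h * g'^-1) * g^-1 / h)%g.
  by rewrite invgM !mulgA.
by rewrite E (mulgA g) -ci_central -!mulgA !mulgA.
Qed.

Lemma comm_pairingDr l m m' : LT l -> LT m -> LT m' ->
  comm_pairing tau l (m + m') = (comm_pairing tau l m * comm_pairing tau l m')%g.
Proof.
move=> /LT_lift[g <-] /LT_lift[h <-] /LT_lift[h' <-]; rewrite -cpM.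
apply: (@ci_inj _ _ tau); rewrite ciM.
have E k : (g * k)%g = (ci tau (comm_pairing tau (cp g) (cp k)) * k * g)%g.
  by rewrite ci_comm_pairing !mulgVK.
rewrite ci_comm_pairing invgM (mulgA g) E -(mulgA _ g) E !mulgA mulgK mulgK.
by rewrite -(mulgA _ h) -(ci_central _ h) !mulgA mulgK.
Qed.

End CommutatorPairing.

(** * Smooth functions of a real variable *)

Section SmoothFunctions.
Variable R : realType.
Implicit Types (f g h : R -> R) (a : R).

Lemma smooth1_derive f : smooth1 f -> smooth1 (derive1 f).
Proof. by move=> sf n x; rewrite -derive1Sn; exact: sf n.+1 x. Qed.

Lemma smooth1_derivable f x : smooth1 f -> derivable f x 1.
Proof. by move=> /(_ 0%N x). Qed.

(** All iterated derivatives stay in [P]. This serves for the constants and for the span of [sin]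
    and [cos], both closed under differentiation. *)
Lemma smooth1_closed (P : set (R -> R)) :
  (forall f, P f -> (forall x, derivable f x 1) /\ P (derive1 f)) ->
  forall f, P f -> smooth1 f.
Proof.
move=> HP f Pf n x; suff Pn : P (derive1n n f) by have [] := HP _ Pn.
by elim: n => //= n IHn; have [] := HP _ IHn.
Qed.

Lemma smooth1_cst a : smooth1 (fun=> a : R).
Proof.
apply: (@smooth1_closed (fun f => exists b, f = fun=> b)); last by exists a.
move=> _ [b ->]; split=> [x|]; first exact: derivable_cst.
by exists 0; apply/funext => x; rewrite derive1E derive_cst.
Qed.

Lemma smooth1_id : smooth1 (@id R).
Proof.
move=> [|n] x; first exact: derivable_id.
rewrite derive1Sn (_ : derive1 id = fun=> 1); first exact: smooth1_cst.
by apply/funext => y; rewrite derive1E derive_id.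
Qed.

Lemma smooth1_sin : smooth1 (@sin R).
Proof.
pose P f := exists a b, f = a *: sin + b *: (@cos R).
apply: (@smooth1_closed P); last first.
  by exists 1, 0; rewrite scale1r scale0r addr0.
move=> _ [a [b ->]].
have D (x : R) : is_derive x 1 (a *: (@sin R) + b *: (@cos R)) (- b * sin x + a * cos x).
  apply: trigger_derive
    (is_deriveD (is_deriveZ a (is_derive_sin x)) (is_deriveZ b (is_derive_cos x))) _.
  by rewrite /GRing.scale /= addrC mulNr mulrN.
split=> [x|]; first by have [] := D x.
exists (- b), a; apply/funext => x; rewrite derive1E.
by have [_ ->] := D x.
Qed.

Lemma smooth2_fst f : smooth1 f -> smooth2 (fun s _ : R => f s).
Proof.
move=> sf k; elim: k f sf => [|k IHk] f sf /=.
  move=> z; apply: (@continuous_comp _ _ _ fst f); first exact: cvg_fst.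
  by apply: differentiable_continuous; apply/derivable1_diffP; exact: smooth1_derivable.
split.
- by move=> s x; split; [exact: smooth1_derivable | exact: derivable_cst].
- by apply: IHk; exact: smooth1_derive.
- rewrite (_ : (fun s x => _) = fun s _ => 0); first exact/IHk/smooth1_cst.
  by apply/funext => s; apply/funext => x; rewrite derive1E derive_cst.
Qed.

(** Near 0, [F] is the given composite precomposed with [asin (e^-1 * s)], which is differentiable
    at 0. *)
Lemma derivable_sin_factor (F : R -> R) (e : R) : 0 < e ->
  derivable (fun s => F (e * sin s)) 0 1 -> derivable F 0 1.
Proof.
move=> e0 dF.
have a0 : asin (0 : R) = 0.
  by rewrite -{1}sin0 sinK// in_itv/= oppr_le0 divr_ge0// pi_ge0.
pose h (s : R) := asin (e^-1 * s).
have dl : is_derive (0 : R) (1 : R) (fun s : R => e^-1 * s) (e^-1 *: 1).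
  exact: (is_deriveZ e^-1 (is_derive_id (0 : R) 1)).
have das : is_derive (e^-1 * 0) (1 : R) asin (Num.sqrt (1 - (e^-1 * 0) ^+ 2))^-1.
  by apply: is_derive1_asin; rewrite mulr0 ltrN10 ltr01.
have dh : is_derive (0 : R) (1 : R) h _ := is_derive1_comp das dl.
have dF0 : is_derive (h 0) (1 : R) (fun s => F (e * sin s))
    (derive1 (fun s => F (e * sin s)) 0).
  by rewrite /h mulr0 a0; apply: DeriveDef => //; rewrite derive1E.
have := ex_derive (is_derive := is_derive1_comp dF0 dh).
apply: near_eq_derivable.
near=> s => /=; rewrite asinK ?mulrA ?mulfV ?mul1r// ?gt_eqF//.
rewrite in_itv /= -ler_norml normrM gtr0_norm ?invr_gt0// ler_pdivrMl// mulr1.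
near: s; exists e => //= s; rewrite /ball_ /= sub0r normrN; exact: ltW.
Unshelve. all: by end_near. Qed.

Lemma pi2_neq0 : 2 * pi != 0 :> R.
Proof. by rewrite mulf_neq0// gt_eqF// pi_gt0. Qed.

End SmoothFunctions.

(** * Additivity and smoothness of [kappa] *)

Section Kappa.
Variables (R : realType) (T : expGroup R) (tau : cext T).
Implicit Types (n v w : lie T) (t : T) (y : ctorus tau).

Lemma LT_cst t : @LT R T (fun=> t).
Proof.
split=> // x0; have [v <-] := texp_surj t; exists (fun=> v); last by near=> x.
by move=> phi; exact: smooth1_cst.
Unshelve. all: by end_near. Qed.

Lemma LT_geodesic n : texp T n = 0 -> LT (geodesic n).
Proof.
move=> n0; split=> [x|x0].
  by rewrite /geodesic mulrDl divff ?pi2_neq0// scalerDl scale1r raddfD n0 addr0.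
exists (fun x => (x / (2 * pi)) *: n); last by near=> x.
move=> phi; rewrite (_ : (fun x => _) = ((2 * pi)^-1 * phi n) *: (@id R)).
  exact/smooth1Z/smooth1_id.
by apply/funext => x; rewrite linearZ /= fctE /GRing.scale /= [RHS]mulrC mulrA.
Unshelve. all: by end_near. Qed.

Lemma LT_curve_line n (h : R -> R) : smooth1 h ->
  LT_curve (fun s _ : R => texp T (h s *: n)).
Proof.
move=> sh; split=> // s0 x0; exists (fun s _ => h s *: n); last by near=> z.
move=> phi; rewrite (_ : (fun s x => _) = fun s _ => ((phi n : R) *: h) s).
  refine (@smooth2_fst R ((phi n : R) *: h) (@smooth1Z R (phi n) h sh)).
by apply/funext => s; apply/funext => x; rewrite linearZ /= /GRing.scale /= mulrC.
Unshelve. all: by end_near. Qed.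

Lemma kappaDl n n' t : texp T n = 0 -> texp T n' = 0 ->
  kappa tau (n + n') t = (kappa tau n t * kappa tau n' t)%g.
Proof.
move=> n0 n'0; rewrite /kappa -comm_pairingDl;
  [|exact: LT_geodesic|exact: LT_geodesic|exact: LT_cst].
by congr comm_pairing; apply/funext => x; rewrite /geodesic scalerDr raddfD.
Qed.

Lemma kappaDr n t t' : texp T n = 0 ->
  kappa tau n (t + t') = (kappa tau n t * kappa tau n t')%g.
Proof.
by move=> n0; rewrite /kappa -comm_pairingDr//;
  [exact: LT_geodesic|exact: LT_cst|exact: LT_cst].
Qed.

Lemma kappa0l t : kappa tau 0 t = 1%g.
Proof.
apply: (@mulgI _ (kappa tau 0 t)).
by rewrite -kappaDl ?raddf0// addr0 mulg1.
Qed.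

Lemma kappa0r n : texp T n = 0 -> kappa tau n 0 = 1%g.
Proof.
by move=> n0; apply: (@mulgI _ (kappa tau n 0)); rewrite -kappaDr// addr0 mulg1.
Qed.

Lemma kappaNl n t : texp T n = 0 -> kappa tau (- n) t = (kappa tau n t)^-1%g.
Proof.
move=> n0; apply: (@mulIg _ (kappa tau n t)).
by rewrite -kappaDl ?raddfN ?n0 ?oppr0// addNr kappa0l mulVg.
Qed.

Lemma cp_ctorus y : cp (val y) = fun=> cp (val y) 0.
Proof. by case/asboolP: (ctorus_valP y) => t /= ->. Qed.

Lemma ctorus_lift t : exists y : ctorus tau, cp (val y) 0 = t.
Proof.
have [g gt] := LT_lift tau (LT_cst t).
have gP : g \in ctorus_pred tau by apply/asboolP; exists t.
by exists (MkCtorus gP); rewrite /= gt.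
Qed.

(** This consequence of [smooth_ext] passes to pull-backs along any map of extensions and suffices
    to translate weights. Thus [smooth_ext] is assumed for [tau] alone. *)
Definition smooth_kappa := forall n, texp T n = 0 ->
  forall c : R -> ctorus tau, csm (val \o c) ->
  smoothU1 (fun s => kappa tau n (cp (val (c s)) 0)).

Hypothesis smooth_tau : smooth_ext tau.

Lemma csm_comm (g : tau) (c : R -> tau) : csm c ->
  csm (fun s => ci tau (comm_pairing tau (cp g) (cp (c s)))).
Proof.
move=> sc; rewrite (_ : (fun s => _) = fun s => (g * c s * g^-1 * (c s)^-1)%g).
  have cc a := csm_cst smooth_tau a.
  have cm := csm_mul smooth_tau.
  exact: cm (cm _ _ (cm _ _ (cc g) sc) (cc _)) (csm_inv smooth_tau sc).
by apply/funext => s; rewrite ci_comm_pairing.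
Qed.

Lemma smooth_ext_kappa : smooth_kappa.
Proof.
move=> n n0 c sc; have [g gn] := LT_lift tau (LT_geodesic n0).
apply/(csm_ci smooth_tau); have := csm_comm g sc; rewrite gn.
by congr csm; apply/funext => s; rewrite /= cp_ctorus.
Qed.

(** The product is taken inside the extension, where [csm_mul] applies. *)
Lemma smoothU1M (u v : R -> U1 R) : smoothU1 u -> smoothU1 v ->
  smoothU1 (fun s => u s * v s)%g.
Proof.
move=> /(csm_ci smooth_tau) su /(csm_ci smooth_tau) sv.
apply/(csm_ci smooth_tau); have := csm_mul smooth_tau su sv.
by congr csm; apply/funext => s; rewrite /= ciM.
Qed.

Let k n v (s : R) := kappa tau n (texp T (s *: v)).

(* [csm_section] only applies to curves staying in U at all times, whence the sine *)
Lemma kappa_line_local n v : texp T n = 0 ->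
  exists2 e : R, 0 < e & smoothU1 (fun s => k n v (e * sin s)).
Proof.
move=> n0; have [g gn] := LT_lift tau (LT_geodesic n0).
have [U [sigma [oU U0 _ csig ssig]]] := csm_section smooth_tau.
have := oU _ (LT_curve_line v (@smooth1_id R)) 0.
rewrite scale0r raddf0 => /(_ U0) /nbhs_ballP[e /= e0 eU].
(* Half the radius, so that the values [e / 2 * sin s], including the extreme ones, lie in the open
   ball. *)
exists (e / 2); first exact: divr_gt0.
have shs : smooth1 (fun s : R => e / 2 * sin s) by exact/smooth1Z/smooth1_sin.
have cU (s : R) : U (fun=> texp T ((e / 2 * sin s) *: v)).
  apply: eU; rewrite -ball_normE /ball_ /= sub0r normrN normrM.
  have e2 : 0 < e / 2 by exact: divr_gt0.
  rewrite gtr0_norm// (le_lt_trans (y := e / 2))//.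
    by rewrite ger_pMr// ler_norml sin_geN1 sin_le1.
  by rewrite ltr_pdivrMr// ltr_pMr// ltr1n.
(* The local section lifts the curve of constant loops smoothly, and its commutator with [g] is
   [kappa] along that curve. *)
have := csm_comm g (ssig _ (LT_curve_line v shs) cU).
rewrite gn => H; apply/(csm_ci smooth_tau); move: H; congr csm.
by apply/funext => s; rewrite /= csig//; exact: LT_cst.
Qed.

Lemma kappa_line_derivable n v : texp T n = 0 ->
  derivable (ReU \o k n v) 0 1 /\ derivable (ImU \o k n v) 0 1.
Proof.
move=> n0; have [e e0 [sR sI]] := kappa_line_local v n0.
by split; apply: (derivable_sin_factor e0); exact: smooth1_derivable.
Qed.

End Kappa.

(** * One-parameter subgroups of the circle *)

Section UnitCircle.
Variable R : realType.
Implicit Types u v : U1 R.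

Lemma ReU_M u v : ReU (u * v)%g = ReU u * ReU v - ImU u * ImU v.
Proof. by rewrite /ReU /ImU /=; case: (val u) => a b; case: (val v). Qed.

Lemma ImU_M u v : ImU (u * v)%g = ReU u * ImU v + ImU u * ReU v.
Proof. by rewrite /ReU /ImU /=; case: (val u) => a b; case: (val v). Qed.

Lemma ReU_ImU_sqr u : ReU u ^+ 2 + ImU u ^+ 2 = 1.
Proof.
have := add_Re2_Im2 (val u); rewrite (eqP (valP u)) expr1n.
by move=> /(congr1 (@complex.Re R)).
Qed.

Lemma U1_eq u v : ReU u = ReU v -> ImU u = ImU v -> u = v.
Proof.
rewrite /ReU /ImU => eR eI; apply/val_inj.
by move: eR eI; case: (val u) => a b; case: (val v) => c d /= -> ->.
Qed.

Section OneParameterSubgroup.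
Variable k : R -> U1 R.
Hypothesis k_morph : forall s t, k (s + t) = (k s * k t)%g.
Hypothesis k_Re : derivable (ReU \o k) 0 1.
Hypothesis k_Im : derivable (ImU \o k) 0 1.

Lemma oneparam0 : k 0 = 1%g.
Proof. by apply: (@mulgI _ (k 0)); rewrite -k_morph addr0 mulg1. Qed.

Lemma is_derive_Im0 : is_derive (0 : R) (1 : R) (ImU \o k) (derive1 (ImU \o k) 0).
Proof. by apply: DeriveDef => //; rewrite derive1E. Qed.

(* Differentiating [Re^2 + Im^2 = 1] at the unit. *)
Lemma is_derive_Re0 : is_derive (0 : R) (1 : R) (ReU \o k) 0.
Proof.
apply: DeriveDef => //; set d := (X in X = _).
have dR : is_derive (0 : R) (1 : R) (ReU \o k) d by apply: DeriveDef.
have dI := is_derive_Im0.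
have D : is_derive (0 : R) (1 : R) ((ReU \o k) ^+ 2 + (ImU \o k) ^+ 2) (2 * d).
  apply: trigger_derive (is_deriveD (is_deriveX 2 dR) (is_deriveX 2 dI)) _.
  rewrite /= oneparam0 /ReU /ImU /= /GRing.scale /= mulr0 mul0r addr0.
  by rewrite expr1 mulr1 mulr2n.
have : is_derive (0 : R) (1 : R) ((ReU \o k) ^+ 2 + (ImU \o k) ^+ 2) 0.
  rewrite (_ : _ + _ = cst 1); first exact: is_derive_cst.
  by apply/funext => s; rewrite !fctE /= ReU_ImU_sqr.
by case: D => _ D [_ /eqP]; rewrite D mulf_eq0 pnatr_eq0 /= => /eqP.
Qed.

(* [k' = k k'(0)], so [k] is constant when [k'(0)] vanishes. *)
Lemma oneparam_trivial : derive1 (ImU \o k) 0 = 0 -> forall s, k s = 1%g.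
Proof.
move=> k'0 s.
have dR := is_derive_Re0; have dI := is_derive_Im0; rewrite k'0 in dI.
have D (t : R) : is_derive t (1 : R) (ReU \o k) 0 /\ is_derive t (1 : R) (ImU \o k) 0.
  (* Translation by [t] carries the derivatives at 0 to those at [t]. *)
  have kE x : k x = (k t * k (x - t))%g by rewrite -k_morph addrC subrK.
  pose c : R -> R := fun x => x - t.
  have dc : is_derive t (1 : R) c 1.
    apply: trigger_derive (is_deriveB (is_derive_id t 1) (is_derive_cst t t 1)) _.
    by rewrite subr0.
  have dRc : is_derive t (1 : R) ((ReU \o k) \o c) (0 * 1).
    by apply: is_derive1_comp; rewrite /c subrr.
  have dIc : is_derive t (1 : R) ((ImU \o k) \o c) (0 * 1).
    by apply: is_derive1_comp; rewrite /c subrr.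
  split.
    rewrite (_ : ReU \o k = ReU (k t) *: ((ReU \o k) \o c) - ImU (k t) *: ((ImU \o k) \o c)).
      apply: trigger_derive (is_deriveB (is_deriveZ _ dRc) (is_deriveZ _ dIc)) _.
      by rewrite mul0r !scaler0 subr0.
    by apply/funext => x; rewrite /= {1}kE ReU_M.
  rewrite (_ : ImU \o k = ReU (k t) *: ((ImU \o k) \o c) + ImU (k t) *: ((ReU \o k) \o c)).
    apply: trigger_derive (is_deriveD (is_deriveZ _ dIc) (is_deriveZ _ dRc)) _.
    by rewrite mul0r !scaler0 addr0.
  by apply/funext => x; rewrite /= {1}kE ImU_M.
rewrite -oneparam0; apply: U1_eq.
  exact: (@is_derive_0_is_cst R (ReU \o k) s 0 (fun t => (D t).1)).
exact: (@is_derive_0_is_cst R (ImU \o k) s 0 (fun t => (D t).2)).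
Qed.

End OneParameterSubgroup.

(** At the unit the real part is 1 and the imaginary part 0, so the product rule for [ImU_M] leaves
    the sum of the velocities. Applied to [kappa] along lines, it makes [kappa_num] additive in each
    argument. *)
Lemma derive_oneparamM (k l : R -> U1 R) (a b : R) :
  k 0 = 1%g -> l 0 = 1%g ->
  is_derive (0 : R) (1 : R) (ReU \o k) 0 -> is_derive (0 : R) (1 : R) (ImU \o k) a ->
  is_derive (0 : R) (1 : R) (ReU \o l) 0 -> is_derive (0 : R) (1 : R) (ImU \o l) b ->
  derive1 (fun s => ImU (k s * l s)%g) 0 = a + b.
Proof.
move=> k0 l0 kR kI lR lI; rewrite derive1E.
rewrite (_ : (fun s => _) = (ReU \o k) * (ImU \o l) + (ImU \o k) * (ReU \o l)); last first.
  by apply/funext => s; rewrite !fctE /= ImU_M.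
have D := is_deriveD (is_deriveM kR lI) (is_deriveM kI lR).
rewrite (derive_val (is_derive := D)) /= k0 l0 /ReU /ImU /= /GRing.scale /=.
by rewrite !mul1r !mul0r addr0 add0r addrC.
Qed.

End UnitCircle.

(** * The bilinear form of the extension and the orthogonal complement *)

Lemma linear_eq_basis (R : realType) (V : vectType R) (b : (\dim {: V}).-tuple V)
    (f g : V -> R^o) :
  basis_of {: V} b -> linear f -> linear g -> (forall i, f b`_i = g b`_i) -> f =1 g.
Proof.
move=> bV lf lg fg v.
pose F : {linear V -> R^o} := HB.pack f (GRing.isLinear.Build R V R^o _ f lf).
pose G : {linear V -> R^o} := HB.pack g (GRing.isLinear.Build R V R^o _ g lg).
rewrite (coord_basis bV (memvf v)) -[f]/(F : V -> R^o) -[g]/(G : V -> R^o) !linear_sum.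
by apply: eq_bigr => i _; rewrite !linearZ /= fg.
Qed.

Section KappaForm.
Variables (R : realType) (T : expGroup R) (tau : cext T).
Hypothesis smooth_tau : smooth_ext tau.
Implicit Types (n m v w : lie T).

Let k n v (s : R) := kappa tau n (texp T (s *: v)).

Let kM n v s t : texp T n = 0 -> k n v (s + t) = (k n v s * k n v t)%g.
Proof. by move=> n0; rewrite /k scalerDl raddfD kappaDr. Qed.

Let k1 n v : texp T n = 0 -> k n v 0 = 1%g.
Proof. by move=> n0; rewrite /k scale0r raddf0 kappa0r. Qed.

Lemma derive_kappa_line n v :
  derive1 (ImU \o k n v) 0 = 2 * pi * kappa_num tau n v.
Proof. by rewrite /kappa_num mulrC divfK// pi2_neq0. Qed.

Lemma is_derive_kappa_line n v : texp T n = 0 ->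
  is_derive (0 : R) (1 : R) (ReU \o k n v) 0 /\
  is_derive (0 : R) (1 : R) (ImU \o k n v) (2 * pi * kappa_num tau n v).
Proof.
move=> n0; have [dR dI] := kappa_line_derivable smooth_tau v n0.
split; first exact: (is_derive_Re0 (fun s t => kM v s t n0)).
by rewrite -derive_kappa_line; exact: is_derive_Im0.
Qed.

Lemma kappa_numDl n n' v : texp T n = 0 -> texp T n' = 0 ->
  kappa_num tau (n + n') v = kappa_num tau n v + kappa_num tau n' v.
Proof.
move=> n0 n'0; apply: (mulfI (pi2_neq0 R)); rewrite [RHS]mulrDr -derive_kappa_line.
have [kR kI] := is_derive_kappa_line v n0; have [lR lI] := is_derive_kappa_line v n'0.
rewrite -(derive_oneparamM (k1 v n0) (k1 v n'0) kR kI lR lI).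
by congr (derive1 _ 0); apply/funext => s; rewrite /= /k kappaDl.
Qed.

Lemma kappa_numDr n v w : texp T n = 0 ->
  kappa_num tau n (v + w) = kappa_num tau n v + kappa_num tau n w.
Proof.
move=> n0; apply: (mulfI (pi2_neq0 R)); rewrite [RHS]mulrDr -derive_kappa_line.
have [kR kI] := is_derive_kappa_line v n0; have [lR lI] := is_derive_kappa_line w n0.
rewrite -(derive_oneparamM (k1 v n0) (k1 w n0) kR kI lR lI).
by congr (derive1 _ 0); apply/funext => s; rewrite /= /k scalerDr raddfD kappaDr.
Qed.

Lemma kappa_numZr n v (a : R) : texp T n = 0 ->
  kappa_num tau n (a *: v) = a * kappa_num tau n v.
Proof.
move=> n0; apply: (mulfI (pi2_neq0 R)); rewrite [RHS]mulrCA -derive_kappa_line.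
have [_ kI] := is_derive_kappa_line v n0.
rewrite derive1E; apply: derive_val.
have da : is_derive (0 : R) (1 : R) (fun s => s * a) a.
  by apply: trigger_derive; rewrite scaler0 add0r /GRing.scale /= mulr1.
have : is_derive (0 : R) (1 : R) ((ImU \o k n v) \o (fun s => s * a))
    (2 * pi * kappa_num tau n v * a).
  by apply: is_derive1_comp; rewrite mul0r.
rewrite mulrC; congr is_derive.
by apply/funext => s; rewrite /= /k scalerA.
Qed.

Lemma kappa_num_linear n : texp T n = 0 ->
  linear (fun v => - kappa_num tau n v : R^o).
Proof.
move=> n0 a v w; rewrite kappa_numDr// kappa_numZr// opprD.
by rewrite scalerN.
Qed.

Lemma kappa_trivial_on n v : texp T n = 0 -> kappa_num tau n v = 0 ->
  kappa tau n (texp T v) = 1%g.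
Proof.
move=> n0 nv0; have [dR dI] := kappa_line_derivable smooth_tau v n0.
have := oneparam_trivial (fun s t => kM v s t n0) dR dI.
rewrite derive_kappa_line nv0 mulr0 => /(_ erefl 1).
by rewrite /k scale1r.
Qed.

Lemma kappa_num_eq0 n v : (forall s : R, kappa tau n (texp T (s *: v)) = 1%g) ->
  kappa_num tau n v = 0.
Proof.
move=> k0; rewrite /kappa_num (_ : (fun s => _) = cst 0).
  by rewrite derive1_cst mul0r.
by apply/funext => s; rewrite k0.
Qed.

Hypothesis torusT : is_torus T.

Lemma torus_lattice_basis : exists b : (\dim {: lie T}).-tuple (lie T),
  [/\ basis_of {: lie T} b, forall i, texp T b`_i = 0 &
   forall n, texp T n = 0 ->
     exists z : 'I_(\dim {: lie T}) -> int, n = \sum_(i < \dim {: lie T}) b`_i *~ z i].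
Proof.
have [b [bT latT]] := torusT; exists b; split=> // [i|n /latT//].
case: (ltnP i (\dim {: lie T})) => [ltid|?]; last first.
  by rewrite nth_default ?raddf0// size_tuple.
(* A basis vector has Kronecker delta coordinates, hence lies in the lattice. *)
apply/latT; exists (fun j => (j == Ordinal ltid)%:Z).
rewrite (bigD1 (Ordinal ltid))//= eqxx big1 ?addr0// => j /negPf ->.
by rewrite mulr0z.
Qed.

(** [tau_form] falls back to 0 unless some bilinear form has the prescribed values, so one has to be
    constructed. *)
Lemma tau_form_spec : [/\ forall v, linear (tau_form tau v),
  forall w, linear ((tau_form tau)^~ w) &
  forall n m, texp T n = 0 -> texp T m = 0 -> tau_form tau n m = - kappa_num tau n m].
Proof.
set P := [set b : lie T -> lie T -> R^o |
  [/\ forall v, linear (b v), forall w, linear (b^~ w) &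
      forall n m, texp T n = 0 -> texp T m = 0 -> b n m = - kappa_num tau n m]].
suff : exists b, P b by move=> /(@xgetPex _ (fun _ _ => 0) P).
have [b [bT b0 latT]] := torus_lattice_basis.
(* For a lattice vector [n], [kappa_num] is already linear in its second argument. Only the first
   argument is extended, by its coordinates in a lattice basis. *)
pose B v w : R^o := \sum_(i < \dim {: lie T}) coord b i v *: (- kappa_num tau b`_i w : R^o).
have Bl v : linear (B v).
  move=> a w w'; rewrite /B scaler_sumr -big_split /=; apply: eq_bigr => i _.
  by rewrite kappa_num_linear// scalerDr !scalerA mulrC.
have Br w : linear (B^~ w).
  move=> a v v'; rewrite /B scaler_sumr -big_split /=; apply: eq_bigr => i _.
  by rewrite linearP scalerDl scalerA.
exists B; split=> // n m n0 _.
(* The lattice condition is carried along because additivity of [kappa_num] in the first argument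
   holds on the lattice. [Q] is then stable under integer combinations of the basis. *)
pose Q n := texp T n = 0 /\ B n m = - kappa_num tau n m.
have kn0 : kappa_num tau 0 m = 0.
  by apply: (@addrI _ (kappa_num tau 0 m)); rewrite -kappa_numDl ?raddf0// !addr0.
have kN x : texp T x = 0 -> kappa_num tau (- x) m = - kappa_num tau x m.
  move=> x0; apply/eqP; rewrite -addr_eq0 -kappa_numDl ?raddfN ?x0 ?oppr0//.
  by rewrite addNr kn0.
pose Bm : {linear lie T -> R^o} := HB.pack (B^~ m)
  (GRing.isLinear.Build R (lie T) R^o _ _ (Br m)).
have BD x y : B (x + y) m = B x m + B y m by exact: (raddfD Bm x y).
have BN x : B (- x) m = - B x m by exact: (raddfN Bm x).
have B0 : B 0 m = 0 by exact: (raddf0 Bm).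
have Q0 : Q 0 by split; rewrite ?raddf0// kn0 B0 oppr0.
have QD x y : Q x -> Q y -> Q (x + y).
  move=> [x0 Bx] [y0 By]; split; first by rewrite raddfD x0 y0 addr0.
  by rewrite BD Bx By kappa_numDl// opprD.
have QN x : Q x -> Q (- x).
  move=> [x0 Bx]; split; first by rewrite raddfN x0 oppr0.
  by rewrite BN Bx kN.
have Qz x (z : int) : Q x -> Q (x *~ z).
  move=> Qx; have Qn j : Q (x *+ j) by elim: j => // j IHj; rewrite mulrS; exact: QD.
  by case: z => j; [exact: Qn|rewrite NegzE mulrNz; exact/QN/Qn].
suff : Q n by case.
have [z ->] := latT n n0; apply: big_ind => // i _; apply: Qz; split=> //.
rewrite /B (bigD1 i)//= big1 ?addr0 => [|j ji].
  by rewrite coord_free ?(basis_free bT)// eqxx scale1r.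
by rewrite coord_free ?(basis_free bT)// eq_sym (negPf ji) scale0r.
Qed.

(** Both sides are linear in [v] and agree on a lattice basis. *)
Lemma tau_formE n v : texp T n = 0 -> tau_form tau n v = - kappa_num tau n v.
Proof.
move=> n0; have [b [bT b0 _]] := torus_lattice_basis.
have [fl _ fE] := tau_form_spec.
by apply: (linear_eq_basis bT (fl n) (kappa_num_linear n0)) => i; exact: fE.
Qed.

(** [orth_space] tests a basis of [V] only; linearity in the second argument covers the rest.
    Linearity in the first is what gives [lker] its meaning. *)
Lemma mem_orth_space (V : {vspace lie T}) v :
  reflect (forall w, w \in V -> tau_form tau v w = 0) (v \in orth_space (tau_form tau) V).
Proof.
have [fl fr _] := tau_form_spec.
have lkerE w u :
    (u \in lker (linfun (fun x => tau_form tau x w))) = (tau_form tau u w == 0).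
  pose F : {linear lie T -> R^o} := HB.pack ((tau_form tau)^~ w)
    (GRing.isLinear.Build R (lie T) R^o _ _ (fr w)).
  by rewrite memv_ker (lfunE F).
rewrite memvE; apply: (iffP subv_bigcapP) => vV; last first.
  by move=> i _; rewrite -memvE lkerE vV// vbasis_mem// mem_nth// size_tuple.
move=> w wV; rewrite (coord_vbasis wV).
pose F : {linear lie T -> R^o} := HB.pack (tau_form tau v)
  (GRing.isLinear.Build R (lie T) R^o _ _ (fl v)).
rewrite -[tau_form tau v]/(F : lie T -> R^o) linear_sum big1// => i _.
have /eqP Fi : tau_form tau v (vbasis V)`_i == 0 by rewrite -lkerE memvE vV.
by rewrite linearZ /= Fi scaler0.
Qed.

(** From here on, real orthogonality enters only through this condition on characters. *)
Lemma mem_perp_space (T' : expGroup R) (f : thom T' T) n : texp T n = 0 ->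
  n \in perp_space f tau <-> forall t, kappa tau n (f t) = 1%g.
Proof.
move=> n0; split=> [/mem_orth_space nV t|k0].
  have [x <-] := texp_surj t; rewrite thomE; apply: kappa_trivial_on => //.
  apply/eqP; rewrite -oppr_eq0 -tau_formE//; apply/eqP/nV.
  by rewrite -(lfunE (tangent f)) memv_img ?memvf.
apply/mem_orth_space => _ /memv_imgP[x _ ->]; rewrite lfunE tau_formE//.
by rewrite kappa_num_eq0 ?oppr0// => s; rewrite -linearZ -thomE.
Qed.

End KappaForm.

(** * Formal sums over possibly infinite sets *)

Section FreeSums.

Lemma freeg_additive_eq (K : choiceType) (V : zmodType)
    (f g : {additive {freeg K / int} -> V}) :
  (forall x : K, f << x >> = g << x >>) -> f =1 g.
Proof.
move=> fg D; elim/freeg_ind_dom0: D => [|k x D _ _ IHD]; first by rewrite !raddf0.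
by rewrite !raddfD IHD -[k]intz -freegU_mulz !raddfMz fg.
Qed.

(** Every inner sum is extended by zero to the whole union and the two sums are exchanged; by
    disjointness each [z] then meets exactly one index. *)
Lemma fsum_bigcup (I K : choiceType) (V : zmodType) (A : set I) (B : I -> set K)
    (F : K -> V) :
  finite_set A -> (forall x, A x -> finite_set (B x)) ->
  (forall x y z, A x -> A y -> B x z -> B y z -> x = y) ->
  \sum_(z \in \bigcup_(x in A) B x) F z = \sum_(x \in A) \sum_(z \in B x) F z.
Proof.
move=> fA fB disj; set S := \bigcup_(x in A) B x.
have fS : finite_set S by exact: bigcup_finite.
transitivity (\sum_(x \in A) \sum_(z \in S) if z \in B x then F z else 0); last first.
  apply: eq_fsbigr => x /set_mem Ax; rewrite -fsbig_mkcondr; congr (\sum_(z \in _) _).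
  by rewrite setIidr// => z Bxz; exists x.
rewrite exchange_fsbig//; apply: eq_fsbigr => z /set_mem[x Ax Bxz].
transitivity (\sum_(y \in A) if y \in [set y | B y z] then F z else 0).
  rewrite -fsbig_mkcondr (_ : A `&` _ = [set x]) ?fsbig_set1//.
  apply/seteqP; split=> [y [Ay Byz]|_ ->]; last by split.
  exact: disj Ay Ax Byz Bxz.
by apply: eq_fsbigr => y _; congr (if _ then _ else _); apply/idP/idP; rewrite !inE.
Qed.

(* A formal sum over an infinite set is 0; if the sets [B x] are all infinite,
   or [A] is, then so is their union, and both sides vanish. *)
Lemma formal_sum_bigcup (I K : choiceType) (A : set I) (B : I -> set K)
    (g : {additive {freeg I / int} -> {freeg K / int}}) :
  (forall x, A x ->
    g (<< x >> : {freeg I / int}) = \sum_(z \in B x) (<< z >> : {freeg K / int})) ->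
  (forall x, A x -> B x !=set0) ->
  (forall x y z, A x -> A y -> B x z -> B y z -> x = y) ->
  (forall x y, A x -> A y -> finite_set (B x) -> finite_set (B y)) ->
  g (\sum_(x \in A) (<< x >> : {freeg I / int})) =
    \sum_(z \in \bigcup_(x in A) B x) (<< z >> : {freeg K / int}).
Proof.
move=> gB Bn0 disj fB; set S := \bigcup_(x in A) B x.
(* Generators are nonzero, so the support of such a sum is all of [C], and the default value 0
   applies. *)
have sumI (L : choiceType) (C : set L) : infinite_set C ->
    \sum_(z \in C) (<< z >> : {freeg L / int}) = 0.
  move=> Cinf; apply: fsbig_dflt; rewrite (_ : _ `&` _ = C)//.
  apply/seteqP; split=> [z []//|z Cz]; split=> //=.
  by apply/eqP; rewrite freegU_eq0.
have [fA|iA] := pselect (finite_set A); last first.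
  rewrite sumI// raddf0 sumI// => fS; apply: iA.
  have [->|/set0P[x0 _]] := eqVneq A set0; first exact: finite_set0.
  (* By disjointness [h] recovers an index from any point of its block. The blocks being nonempty,
     [A] lies in the image of the union under [h]. *)
  pose h z := xget x0 [set x | A x /\ B x z].
  apply: (@sub_finite_set _ _ (h @` S)); last exact: finite_image.
  move=> x Ax; have [z Bxz] := Bn0 _ Ax; exists z; first by exists x.
  have : exists y, A y /\ B y z by exists x.
  move=> /(@xgetPex _ x0 [set y | A y /\ B y z]) [Ahz Bhz].
  exact: disj Ahz Ax Bhz Bxz.
have -> : g (\sum_(x \in A) (<< x >> : {freeg I / int})) =
    \sum_(x \in A) \sum_(z \in B x) (<< z >> : {freeg K / int}).
  rewrite !fsbig_finite// raddf_sum; apply: eq_big_seq => x.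
  by rewrite in_fset_set// => /set_mem/gB.
have [[x Ax]|nB] := pselect (exists2 x, A x & ~ finite_set (B x)); last first.
  rewrite fsum_bigcup// => x Ax; apply: contrapT => nx; by apply: nB; exists x.
move=> iBx; rewrite fsbig1 => [|y Ay]; last first.
  by rewrite sumI// => fy; exact/iBx/(fB _ _ Ay Ax fy).
rewrite sumI// => fS; apply: iBx; apply: sub_finite_set fS => z Bxz; by exists x.
Qed.

End FreeSums.

(** * Orbits of weights *)

Section Orbits.
Variables (R : realType) (T : expGroup R) (tau : cext T).
Implicit Types (lam mu nu : weight tau) (n : lie T).

Lemma weight_eq lam mu : lam =1 mu -> lam = mu.
Proof.
case: lam => f1 a1 b1 c1; case: mu => f2 a2 b2 c2 /= /funext f12.
by move: a1 b1 c1; rewrite f12 => a1 b1 c1; congr Weight; exact: Prop_irrelevance.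
Qed.

Lemma worbitM lam mu n x : (mu x = lam x * kappa tau n (cp (val x) 0))%g ->
  texp T n = 0 -> (lam x = mu x * kappa tau (- n) (cp (val x) 0))%g.
Proof. by move=> -> n0; rewrite kappaNl// mulgK. Qed.

Lemma worbit_refl lam : worbit lam lam.
Proof. by exists 0; rewrite ?raddf0// => x; rewrite kappa0l mulg1. Qed.

Lemma worbit_sym lam mu : worbit lam mu -> worbit mu lam.
Proof.
move=> [n n0 E]; exists (- n) => [|x]; first by rewrite raddfN n0 oppr0.
exact: worbitM.
Qed.

Lemma worbit_trans lam mu nu : worbit lam mu -> worbit mu nu -> worbit lam nu.
Proof.
move=> [n n0 E] [m m0 E']; exists (n + m) => [|x]; first by rewrite raddfD n0 m0 addr0.
by rewrite E' E kappaDl// mulgA.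
Qed.

Lemma worbit_eq lam mu : worbit lam mu -> worbit lam = worbit mu.
Proof.
move=> lm; apply/seteqP; split=> nu; last exact: worbit_trans.
by apply: worbit_trans; exact: worbit_sym.
Qed.

Fact orb_subproof lam : `[< exists mu, worbit lam = worbit mu >].
Proof. by apply/asboolP; exists lam. Qed.

Definition orb lam : orbit_space tau := exist _ (worbit lam) (orb_subproof lam).

Lemma orb_eq lam mu : orb lam = orb mu <-> worbit lam mu.
Proof.
split=> [/(congr1 val) /= ->|lm]; first exact: worbit_refl.
by apply/val_inj; exact: worbit_eq.
Qed.

Lemma orbP (O : orbit_space tau) : exists lam, O = orb lam.
Proof. by have /asboolP[lam E] := valP O; exists lam; apply/val_inj. Qed.

Lemma mem_orb (O : orbit_space tau) lam : val O lam -> O = orb lam.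
Proof. by have [mu ->] := orbP O => /= /orb_eq ->. Qed.

(** [worbit] only compares existing weights. This says that the lattice really acts on them: a
    translate is again a weight, in particular smooth. *)
Definition translatable := forall lam n, texp T n = 0 ->
  exists mu, forall x, (mu x = lam x * kappa tau n (cp (val x) 0))%g.

(** Stability of [smoothU1] under products is a hypothesis because [smoothU1M] derives it from
    [smooth_ext] of some extension; for a pull-back of [tau] it is taken from [tau] itself. *)
Lemma smooth_kappa_translatable :
  (forall u v : R -> U1 R, smoothU1 u -> smoothU1 v -> smoothU1 (fun s => u s * v s)%g) ->
  smooth_kappa tau -> translatable.
Proof.
move=> sM sk lam n n0.
pose w x := (lam x * kappa tau n (cp (val x) 0))%g.
have wMP x y : w (x * y)%g = (w x * w y)%g.
  rewrite /w wM cpM kappaDr// -!mulgA; congr (_ * _)%g.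
  by rewrite !mulgA; congr (_ * _)%g; exact: U1_mulC.
have wci x u : val x = ci tau u -> w x = u.
  move=> xu; rewrite /w (w_ci _ xu) xu (_ : cp _ = 0) ?kappa0r ?mulg1//.
  by apply/cp_ker; exists u.
have wsm c : csm (val \o c) -> smoothU1 (w \o c).
  by move=> sc; apply: sM (w_smooth lam sc) (sk _ n0 _ sc).
by exists (Weight wMP wci wsm).
Qed.

End Orbits.

(** * Orbits under a map of extensions *)

Section Maps.
Variables (R : realType) (T' T : expGroup R) (f : thom T' T).
Variables (tau' : cext T') (tau : cext T) (F : emap f tau' tau).

(** [F] carries lifts to lifts and commutators to commutators, and it is the identity on U(1). *)
Lemma comm_pairing_emap l m : LT l -> LT m ->
  comm_pairing tau' l m = comm_pairing tau (f \o l) (f \o m).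
Proof.
move=> /(LT_lift tau')[g <-] /(LT_lift tau')[h <-].
apply: (@ci_inj _ _ tau); rewrite -!(em_cp F) ci_comm_pairing -(em_ci F).
have F1 : F 1%g = 1%g by apply: (@mulgI _ (F 1%g)); rewrite -emM !mulg1.
have FV k : F k^-1%g = (F k)^-1%g.
  by apply: (@mulgI _ (F k)); rewrite -emM !mulgV F1.
by rewrite ci_comm_pairing !emM !FV.
Qed.

Lemma kappa_emap n t : texp T' n = 0 ->
  kappa tau' n t = kappa tau (tangent f n) (f t).
Proof.
move=> n0; rewrite /kappa comm_pairing_emap; [|exact: LT_geodesic|exact: LT_cst].
by congr comm_pairing; apply/funext => x; rewrite /geodesic /= thomE linearZ.
Qed.

Lemma texp_tangent n : texp T' n = 0 -> texp T (tangent f n) = 0.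
Proof. by move=> n0; rewrite -thomE n0 raddf0. Qed.

Lemma cp_ectorus x : cp (val (ectorus F x)) 0 = f (cp (val x) 0).
Proof. by rewrite /= em_cp. Qed.

Lemma smooth_kappa_emap : smooth_kappa tau -> smooth_kappa tau'.
Proof.
move=> sk n n0 c sc.
have := sk _ (texp_tangent n0) (ectorus F \o c) (em_csm F sc).
by congr smoothU1; apply/funext => s; rewrite kappa_emap //= em_cp.
Qed.

Hypothesis tau_tr : translatable tau.

(** Translating [tdf F lam] by [n] is the same as pulling back the translate of [lam] by
    [tangent f n], which is a weight by [tau_tr]. So the orbit of any pulled-back weight stays
    inside the image. *)
Lemma tdf_orbit_sub (O : orbit_space tau) :
  [set O' : orbit_space tau' | val O' `<=` tdf F @` val O] = (@orb _ _ tau' \o tdf F) @` val O.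
Proof.
apply/seteqP; split=> [Q sQ|_ [lam Olam <-] mu [n n0 E]].
  have [mu Qmu] := orbP Q; subst Q.
  have [lam Olam E] := sQ mu (worbit_refl mu); exists lam => //.
  by rewrite /= E.
have [nu Enu] := tau_tr lam (texp_tangent n0); exists nu; last first.
  by apply: weight_eq => x; rewrite E /= Enu kappa_emap//= em_cp.
by rewrite (mem_orb Olam); exists (tangent f n) => //; exact: texp_tangent.
Qed.

Lemma char_orbitE lam : char_orbit F (orb lam) =
  \sum_(O' \in (@orb _ _ tau' \o tdf F) @` worbit lam)
    (<< O' >> : {freeg (orbit_space tau') / int}).
Proof. by rewrite /char_orbit tdf_orbit_sub. Qed.

(* The coincidences among the orbits of [tdf F (lam + kappa n)] do not depend on [lam]. *)
Lemma finite_tdf_orbits lam mu :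
  finite_set ((@orb _ _ tau' \o tdf F) @` worbit lam) ->
  finite_set ((@orb _ _ tau' \o tdf F) @` worbit mu).
Proof.
set A := _ @` worbit lam; set B := _ @` worbit mu => fA.
(* Pairs the translates of [lam] and [mu] by one and the same lattice vector. *)
pose rel (lam' mu' : weight tau) := exists2 n, texp T n = 0 & forall x,
  (lam' x = lam x * kappa tau n (cp (val x) 0))%g /\
  (mu' x = mu x * kappa tau n (cp (val x) 0))%g.
have rel_orb l1 m1 l2 m2 : rel l1 m1 -> rel l2 m2 ->
    orb (tdf F l1) = orb (tdf F l2) -> orb (tdf F m1) = orb (tdf F m2).
  move=> [n1 n10 E1] [n2 n20 E2] /orb_eq[m m0 E]; apply/orb_eq; exists m => // x.
  rewrite /= (E1 _).2 (E2 _).2 -mulgA; congr (_ * _)%g.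
  (* Cancelling [lam] leaves an identity between values of [kappa] alone, which holds for [mu] as
     well. *)
  apply: (@mulgI _ (lam (ectorus F x))); rewrite mulgA.
  by have := E x; rewrite /= (E1 _).1 (E2 _).1.
(* The map on orbits induced by [rel]; by [rel_orb] its value does not depend on the chosen pair. *)
pose h O := xget (orb (tdf F mu)) [set O' | exists l m,
  [/\ rel l m, O = orb (tdf F l) & O' = orb (tdf F m)]].
apply: (@sub_finite_set _ _ (h @` A)); last exact: finite_image.
move=> _ [m2 [n n0 E2] <-].
have [l2 El2] := tau_tr lam n0.
have r2 : rel l2 m2 by exists n => // x; split.
exists (orb (tdf F l2)); first by exists l2 => //; exists n.
have : exists O', exists l m,
    [/\ rel l m, orb (tdf F l2) = orb (tdf F l) & O' = orb (tdf F m)].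
  by exists (orb (tdf F m2)), l2, m2.
move=> /(@xgetPex _ (orb (tdf F mu)) [set O' | _])[l [m [r E]]].
by rewrite -/(h _) => ->; apply: rel_orb r r2 _.
Qed.

End Maps.

HB.instance Definition _ (R : realType) (T' T : expGroup R) (f : thom T' T)
    (tau' : cext T') (tau : cext T) (F : emap f tau' tau) :=
  GRing.isZmodMorphism.Build (char_group tau) (char_group tau') (char F)
    (lift_is_additive (char_orbit F)).

Lemma charU (R : realType) (T' T : expGroup R) (f : thom T' T)
    (tau' : cext T') (tau : cext T) (F : emap f tau' tau) (O : orbit_space tau) :
  char F (<< O >> : {freeg (orbit_space tau) / int}) = char_orbit F O.
Proof. by rewrite /char liftU scale1r. Qed.

(** * The canonical decomposition *)

Section Decomposition.
Variables (R : realType) (T' T : expGroup R) (f : thom T' T) (tau : cext T).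
Hypothesis torusT : is_torus T.
Hypothesis smooth_tau : smooth_ext tau.

Let q := decomp_q f.
Let i1 := decomp_i1 f tau.
Let fj := decomp_fj f tau.
Let a := thom_comp fj i1.
Let Ef := pb_proj f tau.
Let Eq : emap q (pullback f tau) (pullback a tau) := pb_map (b := f) (decompE f tau) tau.
Let Ei : emap i1 (pullback a tau) (pullback fj tau) :=
  pb_map (h := i1) (a := fj) (b := a) (fun=> erefl) tau.
Let Ej := pb_proj fj tau.

(** All these maps keep the component in [tau], so both sides evaluate [lam] at the same element. *)
Lemma tdf_decomp lam : tdf Ef lam = tdf Eq (tdf Ei (tdf Ej lam)).
Proof. by apply: weight_eq => x; rewrite /=; congr (lam _); apply/val_inj. Qed.

Lemma kappa_pullback (S : expGroup R) (b : thom S T) n t : texp S n = 0 ->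
  kappa (pullback b tau) n t = kappa tau (tangent b n) (b t).
Proof. exact: (kappa_emap (pb_proj b tau)). Qed.

Lemma translatable_pullback (S : expGroup R) (b : thom S T) :
  translatable (pullback b tau).
Proof.
apply: smooth_kappa_translatable; first exact: smoothU1M smooth_tau.
exact: smooth_kappa_emap (pb_proj b tau) (smooth_ext_kappa smooth_tau).
Qed.

Lemma translatable_ext : translatable tau.
Proof.
by apply: smooth_kappa_translatable; [exact: smoothU1M smooth_tau|exact: smooth_ext_kappa].
Qed.

Lemma q_surj (t : quot_torus f) : exists t', q t' = t.
Proof. exact: kerpi_surj. Qed.

Lemma a_q t' : a (q t') = f t'.
Proof. exact: decompE. Qed.

Lemma tangent_a n : tangent a n = tangent f n.
Proof.
have -> : tangent a n = tangent f n + vsval (0 : subvs_of (perp_space f tau)) by [].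
by rewrite raddf0 addr0.
Qed.

(** The constant loop under [y] is lifted through [q] and the component in [tau] is kept; the pair
    lies in the pull-back along [f] since [a \o q] is [f]. *)
Lemma ectorus_q_surj (y : ctorus (pullback a tau)) : exists x, ectorus Eq x = y.
Proof.
have [t' qt'] := q_surj (cp (val y) 0).
have yt : cp (val y) = fun=> q t' by rewrite cp_ctorus qt'.
have xP : ((fun=> t'), (val (val y)).2) \in pb_pred f tau.
  apply/asboolP; split; first exact: LT_cst.
  have /asboolP[_ ey] := pb_valP (val y).
  rewrite /= [LHS]ey; change (a \o cp (val y) = f \o fun=> t').
  by rewrite yt; apply/funext => s; exact: a_q.
have xct : (MkPb xP : pullback f tau) \in ctorus_pred (pullback f tau).
  by apply/asboolP; exists t'.
exists (MkCtorus xct); apply/val_inj/val_inj => /=.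
by rewrite [RHS]surjective_pairing; congr (_, _); rewrite -[RHS]/(cp (val y)) yt.
Qed.

(** The image of [n] under [tangent q] realizes the translation, which is checked at every [y] by
    writing it as an image under [Eq]. *)
Lemma worbit_tdf_q nu nu' :
  worbit (tdf Eq nu) (tdf Eq nu') -> worbit nu nu'.
Proof.
move=> [n n0 E]; exists (tangent q n) => [|y]; first exact: texp_tangent.
have [x <-] := ectorus_q_surj y; have := E x; rewrite /= => ->.
by rewrite (kappa_emap Eq)//.
Qed.

Lemma kappa_perp n (t : quot_torus f) : texp T n = 0 -> n \in perp_space f tau ->
  kappa tau n (a t) = 1%g.
Proof.
move=> n0 /(mem_perp_space smooth_tau torusT f n0) nk; have [t' <-] := q_surj t.
by rewrite a_q.
Qed.

Lemma texp_quot n : texp (quot_torus f) n = 0 -> texp T (tangent f n) = 0.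
Proof. by move=> n0; have := texp_tangent a n0; rewrite tangent_a. Qed.

Lemma texp_perp (n : subvs_of (perp_space f tau)) :
  texp (perp_torus f tau) n = 0 <-> texp T (vsval n) = 0.
Proof.
split=> [n0|n0]; first exact: (texp_tangent (sub_incl (perp_space f tau)) n0).
apply/eqP; rewrite -[X in _ == X](raddf0 (kerpi (sub_exp (perp_space f tau)))).
by rewrite /= /kerpi -Quotient.idealrBE subr0 /in_mem /= /kerp /= n0.
Qed.

Lemma kappa_fj (n1 : lie T') (n2 : subvs_of (perp_space f tau)) t :
  texp (quot_torus f) n1 = 0 -> texp T (vsval n2) = 0 ->
  kappa (pullback fj tau) (n1, n2) t =
    (kappa tau (tangent f n1) (fj t) * kappa tau (vsval n2) (fj t))%g.
Proof.
move=> n10 n20; rewrite -kappaDl ?texp_quot//; apply: kappa_pullback.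
by congr (_, _); last exact/texp_perp.
Qed.

(** A lattice vector of the product is a pair. Its component in the complement acts trivially on the
    first factor by [kappa_perp], so only the translations by the lattice of that factor survive. *)
Lemma tdf_i1_worbit mu : tdf Ei @` worbit mu = worbit (tdf Ei mu).
Proof.
apply/seteqP; split=> [_ [mu' [[n1 n2] [n10 n20] E] <-]|nu [n n0 E]].
  have n20' := (texp_perp n2).1 n20.
  exists n1 => // x; rewrite /= E; congr (_ * _)%g.
  rewrite kappa_fj// (kappa_pullback a)// -[fj _]/(a (cp (val x) 0)).
  rewrite (kappa_perp _ n20') ?subvsP// mulg1.
  by rewrite tangent_a.
have n0' : texp (prod_torus (quot_torus f) (perp_torus f tau)) (tangent i1 n) = 0.
  exact: texp_tangent n0.
have [mu' Emu'] := translatable_pullback mu n0'.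
exists mu'; first by exists (tangent i1 n).
by apply: weight_eq => x; rewrite E /= Emu' (kappa_emap Ei).
Qed.

(** If translation by [m] becomes translation by [n1] on the first factor, then [kappa] of
    [m - tangent f n1] is trivial on the image of [f]. Hence this difference is orthogonal and [m]
    comes from the product lattice. *)
Lemma worbit_tdf_j lam lam' : worbit lam lam' ->
  worbit (tdf Ei (tdf Ej lam)) (tdf Ei (tdf Ej lam')) ->
  worbit (tdf Ej lam) (tdf Ej lam').
Proof.
move=> [m m0 Em] [n1 n10 En].
have df0 := texp_quot n10.
have mn0 : texp T (m - tangent f n1) = 0 by rewrite raddfB m0 df0 subrr.
have mP : m - tangent f n1 \in perp_space f tau.
  apply/(mem_perp_space smooth_tau torusT f mn0) => t'.
  have [x xt] := ctorus_lift (pullback a tau) (q t').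
  rewrite kappaDl ?raddfN ?df0 ?oppr0// kappaNl//.
  have := En x; rewrite /= Em kappa_pullback// tangent_a => /mulgI.
  rewrite -[cp (pb_val _).2 0]/(cp (val (ectorus (pb_proj a tau) x)) 0).
  by rewrite cp_ectorus xt a_q => ->; rewrite [pb_cp _ 0]xt a_q mulgV.
have n20 : texp T (vsval (vsproj (perp_space f tau) (m - tangent f n1))) = 0.
  by rewrite vsprojK.
(* [vsproj] merely retypes the difference, which lies in the subspace by [mP]. *)
exists (n1, vsproj (perp_space f tau) (m - tangent f n1)) => [|x].
  by congr (_, _); last exact/texp_perp.
rewrite kappa_fj// vsprojK// -kappaDl// subrKC /= Em; congr (_ * kappa _ _ _)%g.
exact: (cp_ectorus Ej).
Qed.

Lemma char_decomp (x : char_group tau) :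
  char Ef x = char Eq (char Ei (char Ej x)).
Proof.
move: x; apply: (freeg_additive_eq (f := char Ef) (g := char Eq \o char Ei \o char Ej)) => O.
have [lam ->] := orbP O.
rewrite /= !charU !char_orbitE; [|exact: translatable_ext|exact: translatable_ext].
set A := (@orb _ _ (pullback fj tau) \o tdf Ej) @` worbit lam.
(* The block over [O1]: the orbits for [q] met by the pull-back of [O1] along [i1], itself a single
   orbit. *)
pose B (O1 : orbit_space (pullback fj tau)) :=
  (@orb _ _ (pullback f tau) \o tdf Eq) @` (tdf Ei @` val O1).
have BE mu : B (orb mu) = (@orb _ _ (pullback f tau) \o tdf Eq) @` worbit (tdf Ei mu).
  by rewrite /B /= tdf_i1_worbit.
rewrite -[RHS]/((char Eq \o char Ei) _) (formal_sum_bigcup (B := B)).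
- congr (\sum_(_ \in _) _); apply/seteqP; split.
    move=> _ [mu lmu <-]; exists (orb (tdf Ej mu)); first by exists mu.
    exists (tdf Ei (tdf Ej mu)); last by rewrite /= tdf_decomp.
    by exists (tdf Ej mu) => //; exact: worbit_refl.
  move=> _ [_ [mu lmu <-] [_ [nu munu <-] <-]].
  (* Any [nu] in an orbit of [A], not only the chosen representative, is a pull-back along [fj]; the
     other description of [A] in [tdf_orbit_sub] yields this. *)
  have : orb (tdf Ej mu) \in A by apply/mem_set; exists mu.
  rewrite /A -(tdf_orbit_sub Ej translatable_ext (orb lam)) => /set_mem /(_ nu munu).
  by case=> mu' lmu' <-; exists mu' => //; rewrite /= tdf_decomp.
(* [char Ei] sends a generator to a single generator, to which [char Eq] then applies. *)
- move=> O1 _; have [mu ->] := orbP O1; rewrite BE /= charU char_orbitE.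
    rewrite (_ : _ @` worbit mu = [set orb (tdf Ei mu)]) ?fsbig_set1.
      by rewrite charU char_orbitE //; exact: translatable_pullback.
    apply/seteqP; split=> [_ [nu munu <-]|_ ->]; last first.
      by exists mu => //; exact: worbit_refl.
    by apply/esym/orb_eq; rewrite -tdf_i1_worbit; exists nu.
  exact: translatable_pullback.
- move=> O1 _; have [mu ->] := orbP O1; rewrite BE.
  by exists (orb (tdf Eq (tdf Ei mu))), (tdf Ei mu) => //; exact: worbit_refl.
- move=> _ _ z [mu lmu <-] [nu lnu <-]; rewrite !BE.
  move=> [mu' mumu' <-] [nu' nunu' /esym /orb_eq /worbit_tdf_q munu'].
  apply/orb_eq/worbit_tdf_j; first exact: worbit_trans (worbit_sym lmu) lnu.
  exact: worbit_trans mumu' (worbit_trans munu' (worbit_sym nunu')).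
- move=> O1 O2 _ _; have [mu ->] := orbP O1; have [nu ->] := orbP O2; rewrite !BE.
  by apply: finite_tdf_orbits; exact: translatable_pullback.
Qed.

End Decomposition.

Theorem theorem3p12 (R : realType) (T' T : expGroup R) (f : thom T' T) (tau : cext T) :
  is_torus T' -> is_torus T -> injective (tangent f) -> positive_ext tau ->
  let q := decomp_q f in
  let i1 := decomp_i1 f tau in
  let fj := decomp_fj f tau in
  let char_f := char (pb_proj f tau) in
  let char_q := char (pb_map (b := f) (decompE f tau) tau) in
  let char_i1 := char (pb_map (h := i1) (a := fj) (b := thom_comp fj i1) (fun=> erefl) tau) in
  let char_fj := char (pb_proj fj tau) in
  forall x : char_group tau, char_f x = char_q (char_i1 (char_fj x)).
Proof. by move=> _ torusT _ [smooth_tau _]; exact: char_decomp. Qed.
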